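(* Suppose that $f:\mathbb{R}^n\to\mathbb{R}$ is $C^{1,1}$. Then $$\partial_{\mathrm{C}}^2 f(\boldsymbol{x})(\boldsymbol{w})=\partial_{\mathrm{C}}\langle\boldsymbol{w},\nabla f\rangle(\boldsymbol{x})\quad\text{for all }\boldsymbol{x},\boldsymbol{w}\in\mathbb{R}^n.$$
   Context: A function $f:\mathbb{R}^n\to\mathbb{R}$ is $C^{1,1}$ if it is differentiable with Lipschitz continuous gradient. $\langle\boldsymbol{w},\nabla f\rangle$ denotes the function $\boldsymbol{x}\mapsto\langle\boldsymbol{w},\nabla f(\boldsymbol{x})\rangle$. For a Lipschitz function $g:\mathbb{R}^n\to\mathbb{R}$, the Clarke subdifferential $\partial_{\mathrm{C}}g(\boldsymbol{x})$ is the convex hull of the set of all limits $\lim_j\nabla g(\boldsymbol{y}_j)$ along sequences $\boldsymbol{y}_j\to\boldsymbol{x}$ of points at which $g$ is differentiable. For a $C^{1,1}$-function $f$, the Clarke generalized Hessian $\partial_{\mathrm{C}}^2f(\boldsymbol{x})\subseteq\mathbb{R}^{n\times n}_{\mathrm{sym}}$ is the convex hull of the set of all limits $\lim_j\nabla^2f(\boldsymbol{y}_j)$ along sequences $\boldsymbol{y}_j\to\boldsymbol{x}$ of points at which $f$ is twice differentiable, and $\partial_{\mathrm{C}}^2f(\boldsymbol{x})(\boldsymbol{w}):=\{\boldsymbol{A}\boldsymbol{w}:\boldsymbol{A}\in\partial_{\mathrm{C}}^2f(\boldsymbol{x})\}$. *)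

(* Defs.v *)
From HB Require Import structures.
From mathcomp Require Import all_boot all_order all_algebra.
From mathcomp Require Import all_classical all_reals all_analysis.

Set Implicit Arguments.
Unset Strict Implicit.
Unset Printing Implicit Defensive.

Import Order.TTheory GRing.Theory Num.Theory.
Import numFieldNormedType.Exports.

Local Open Scope classical_set_scope.
Local Open Scope ring_scope.

(* R^n is 'cV[R]_n, which the library equips with the sup norm; since all norms
   on R^n are equivalent, differentiability, convergence and Lipschitz
   continuity are the usual ones. *)

Section Defs.
Context {R : realType} {n : nat}.
Implicit Types (f g : 'cV[R]_n -> R) (x w : 'cV[R]_n).

Definition inner (u v : 'cV[R]_n) : R := \sum_i u i 0 * v i 0.

(* ['D_v f x] is total; [gradient f x] is meaningful when f is differentiable
   at x, and [hessian f x] when f is twice differentiable at x. *)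
Definition gradient f x : 'cV[R]_n := \col_i 'D_(delta_mx i 0) f x.

(* The Jacobian matrix of the gradient: entry (i, j) is the j-th partial
   derivative of the i-th partial derivative of f. *)
Definition hessian f x : 'M[R]_n :=
  \matrix_(i, j) 'D_(delta_mx j 0) (fun y => gradient f y i 0) x.

Definition twice_differentiable f x : Prop :=
  (\forall y \near x, differentiable f y) /\ differentiable (gradient f) x.

Definition C11 f : Prop :=
  (forall x, differentiable f x) /\ lipschitz (gradient f).

Definition convex_hull (M : lmodType R) (A : set M) : set M :=
  smallest (@convex_set R M) A.

Definition limiting_gradients g x : set 'cV[R]_n :=
  [set v | exists y : nat -> 'cV[R]_n,
     [/\ forall j, differentiable g (y j),
         y j @[j --> \oo] --> x &
         gradient g (y j) @[j --> \oo] --> v]].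

Definition clarke_subdifferential g x : set 'cV[R]_n :=
  convex_hull (limiting_gradients g x).

Definition limiting_hessians f x : set 'M[R]_n :=
  [set A | exists y : nat -> 'cV[R]_n,
     [/\ forall j, twice_differentiable f (y j),
         y j @[j --> \oo] --> x &
         hessian f (y j) @[j --> \oo] --> A]].

Definition clarke_hessian f x : set 'M[R]_n :=
  convex_hull (limiting_hessians f x).

Definition clarke_hessian_apply f x w : set 'cV[R]_n :=
  [set A *m w | A in clarke_hessian f x].

End Defs.

(* Main.v *)
Require Import Defs.
From HB Require Import structures.
From mathcomp Require Import all_boot all_order all_algebra.
From mathcomp Require Import all_classical all_reals all_analysis.
From mathcomp Require Import measurable_realfun ring lra.
Set Implicit Arguments.
Unset Strict Implicit.
Unset Printing Implicit Defensive.
Import Order.TTheory GRing.Theory Num.Theory.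
Import numFieldNormedType.Exports.
Local Open Scope classical_set_scope.
Local Open Scope ring_scope.

(** Write g for the function y |-> <w, grad f(y)>.  Where grad f is
    differentiable, so is g, and grad g = H^T w = H w for the Hessian H of f,
    because H is symmetric ([hessian_sym]).  So every A w with A a limiting
    Hessian at x is a limiting gradient of g at x, and one inclusion follows
    since the linear map A |-> A w commutes with taking convex hulls.

    The converse is not immediate: g may be differentiable at points where
    grad f is not, so a limiting gradient v of g need not be a limit of vectors
    H w.  It does lie in their convex hull.  The set K of the vectors A w, with A
    a limiting Hessian at x, is compact: it is closed, and bounded because
    grad f is Lipschitz.  For a compact K, the vector v belongs to the
    convex hull as soon as each direction d admits some u in K with
    <d, v> <= <d, u> ([convex_hull_of_support]).  To find u
    ([limiting_gradient_support]), take a point y close to x with grad g(y) close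
    to v.  For small t the increment g(y + t d) - g(y) is almost t <d, v>, and by
    continuity it stays so when y is moved slightly.  By Rademacher's theorem
    ([lipschitz_ae_differentiable]) grad f is differentiable almost everywhere,
    and by Fubini's theorem y can be moved so that grad f is differentiable at
    almost every point of the line through y with direction d
    ([lines_of_null]).  As g is Lipschitz on this line, the increment is the
    integral of <d, H w>, so <d, H w> is nearly <d, v> or larger at some point of
    the line close to x ([nearby_hessian]).  Letting the errors vanish, a
    cluster point of these Hessians provides u = A w.

    Three ingredients are built for this purpose.

    In dimension one, a Lipschitz function becomes nondecreasing after adding a
    multiple of the identity.  The Lebesgue-Stieltjes measure of the sum has a
    density h with respect to Lebesgue measure, and Lebesgue differentiation
    identifies h almost everywhere with the derivative.

    In dimension n, only null sets matter.  They are those of a probability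
    measure on Borel sets which is quasi-invariant: translations preserve null
    sets ([exists_quasi_invariant]).  Such a measure is the law of n independent
    Gaussian variables.  Quasi-invariance and Fubini's theorem show that a Borel
    set is null if and only if almost every line in a given direction meets it in
    a null set.

    Rademacher's theorem is proved one coordinate at a time, along the
    subspaces spanned by the first j basis vectors.  Let E be the closed set of
    points where g is affine up to an error e |h| for displacements h in the
    subspace with |h| <= r, the slope being fixed.  The distance to E is a
    Lipschitz function, so it has at almost every y a derivative in the next
    direction v.  At points y of E this derivative vanishes, because the distance
    is minimal there.  Hence y + t v is at distance o(t) from E, and the affine
    approximation available at a nearby point of E can be transported to
    y + t v. *)

(** * Almost everywhere statements *)

Section InverseSuccessors.
Context {R : realType}.

Lemma inv_bound_lt (e : R) : 0 < e -> (Num.bound e^-1).+1%:R^-1 < e.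
Proof.
move=> e0; rewrite invf_plt ?posrE//.
by rewrite (lt_trans (archi_boundP _)) ?invr_ge0 ?ltW// ltr_nat.
Qed.

Lemma near_inv_le (e : R) : 0 < e -> \forall j \near \oo, j.+1%:R^-1 <= e.
Proof.
move=> e0; exists (Num.bound e^-1) => // j /= bj.
apply: le_trans (ltW (inv_bound_lt e0)).
by rewrite lef_pV2 ?posrE// ler_nat ltnS.
Qed.

End InverseSuccessors.

Section AlmostEverywhere.
Context d (T : measurableType d) (R : realType) (mu : {measure set T -> \bar R}).

Lemma ae_imply (P Q : T -> Prop) : (forall x, P x -> Q x) ->
  {ae mu, forall x, P x} -> {ae mu, forall x, Q x}.
Proof. by move=> PQ; apply: negligibleS => x nQ /PQ. Qed.

Lemma ae_imply2 (P Q S : T -> Prop) : (forall x, P x -> Q x -> S x) ->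
  {ae mu, forall x, P x} -> {ae mu, forall x, Q x} -> {ae mu, forall x, S x}.
Proof.
move=> PQS mP mQ; apply: negligibleS (negligibleU mP mQ) => x nS.
by have [Px|nPx] := pselect (P x); [right => /(PQS _ Px)|left].
Qed.

Lemma probability_null_compl (P : probability T R) (N : set T) :
  P N = 0%E -> exists x, ~ N x.
Proof.
move=> N0; apply: contrapT => /forallNP H.
have NT : N = setT.
  by apply/seteqP; split => // x _; apply: contrapT; exact: H.
have := @probability_setT _ _ _ P; rewrite -NT N0 => -[] /esym/eqP.
by rewrite oner_eq0.
Qed.

Lemma ae_forall_countable (I : countType) (P : I -> T -> Prop) :
  (forall i, {ae mu, forall x, P i x}) -> {ae mu, forall x, forall i, P i x}.
Proof.
move=> aeP.
have : {ae mu, forall x, forall k i, @unpickle I k = Some i -> P i x}.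
  apply/ae_foralln => k; case: (@unpickle I k) => [i|]; last exact: aeW.
  by move: (aeP i); apply: ae_imply => x Px j [<-].
by apply: ae_imply => x Px i; apply: (Px (pickle i)); rewrite pickleK.
Qed.

End AlmostEverywhere.

(** * Lipschitz functions of one real variable *)

Section LipschitzContinuity.
Context {R : realType} {V W : normedModType R}.

Lemma lipschitz_bound_continuous (f : V -> W) (L : R) :
  (forall x y, `|f x - f y| <= L * `|x - y|) -> continuous f.
Proof.
move=> fL x; apply/cvgrPdist_le => /= e e0.
have L0 : 0 < `|L| + 1 by rewrite ltr_wpDl.
apply/nbhs_ballP; exists (e / (`|L| + 1)) => /=; first by rewrite divr_gt0.
move=> y; rewrite -ball_normE /= => xy; rewrite (le_trans (fL _ _))//.
rewrite (@le_trans _ _ ((`|L| + 1) * `|x - y|))//.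
  by rewrite ler_wpM2r// (le_trans (ler_norm _))// lerDl.
by rewrite -ler_pdivlMl// mulrC ltW.
Qed.

End LipschitzContinuity.

Section OneDim.
Context {R : realType}.
Local Notation mu := (@lebesgue_measure R).

Lemma lebesgue_stieltjes_oc (F : cumulative R R) (a b : R) : a <= b ->
  lebesgue_stieltjes_measure F `]a, b] = (F b - F a)%:E.
Proof.
move=> ab; rewrite /lebesgue_stieltjes_measure /measure_extension/=.
by rewrite measurable_mu_extE/= ?wlength_itv_bnd//; exact: is_ocitv.
Qed.

(** Both F and c id - F are cumulative functions, and their
    Lebesgue-Stieltjes measures add up to c times Lebesgue measure. *)
Lemma lebesgue_stieltjes_le (F : cumulative R R) (c : R) : 0 <= c ->
  (forall s t, s <= t -> F t - F s <= c * (t - s)) ->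
  forall A, measurable A -> (lebesgue_stieltjes_measure F A <= c%:E * mu A)%E.
Proof.
move=> c0 FL.
pose H (x : R) := c * x.
have Hnd : {homo H : x y / x <= y} by move=> x y xy; rewrite /H ler_wpM2l.
have Hc : continuous H by move=> x; apply: mulrl_continuous.
pose Hm := isCumulative.Build R _ R H Hnd (right_continuousW Hc).
pose Hcum : cumulative R R := HB.pack H Hm.
pose G (x : R) := c * x - F x.
have Gnd : {homo G : x y / x <= y}.
  by move=> x y xy; rewrite /G; have := FL _ _ xy; lra.
have Grc : right_continuous G.
  move=> x; apply: cvgB; first exact: (right_continuousW Hc).
  exact: cumulative_is_right_continuous.
pose Gm := isCumulative.Build R _ R G Gnd Grc.
pose Gcum : cumulative R R := HB.pack G Gm.
pose cn : {nonneg R} := NngNum c0.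
have HE1 A : measurable A -> lebesgue_stieltjes_measure Hcum A =
   measure_add (lebesgue_stieltjes_measure F) (lebesgue_stieltjes_measure Gcum) A.
  apply: lebesgue_stieltjes_measure_unique => X /ocitvP[->|[[a b]/= ab ->]].
    by rewrite !measure0.
  rewrite [RHS](measure_addE _ _ _) !lebesgue_stieltjes_oc ?ltW//.
  transitivity ((F b - F a)%:E + (G b - G a)%:E)%E; last first.
    by congr (_ + _)%E; apply/esym/lebesgue_stieltjes_oc/ltW.
  rewrite -EFinD; congr EFin.
  by rewrite /= /H /G; ring.
have HE2 A : measurable A -> lebesgue_stieltjes_measure Hcum A =
   mscale cn mu A.
  apply: lebesgue_stieltjes_measure_unique => X /ocitvP[->|[[a b]/= ab ->]].
    by rewrite !measure0.
  rewrite !lebesgue_stieltjes_oc ?ltW//.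
  transitivity (c%:E * (b - a)%:E)%E; last first.
    by congr (_ * _)%E; apply/esym/(lebesgue_stieltjes_oc idfun)/ltW.
  rewrite -EFinM; congr EFin; rewrite /= /H; ring.
move=> A mA; have := HE2 _ mA; rewrite HE1//.
rewrite [X in X = _ -> _](measure_addE _ _ _) => H2.
rewrite [leRHS](_ : _ = mscale cn mu A)// -H2.
by rewrite leeDl.
Qed.


(** The function phi + L id is nondecreasing and 2L-Lipschitz, so its
    Lebesgue-Stieltjes measure is absolutely continuous; h is its
    Radon-Nikodym derivative.  The restriction to a bounded interval makes this
    measure finite. *)
Lemma lipschitz_primitive (phi : R -> R) (L k : R) : 0 <= L -> 0 < k ->
  (forall s t, `|phi s - phi t| <= L * `|s - t|) ->
  exists h : R -> R, [/\ forall t, 0 <= h t, mu.-integrable setT (EFin \o h) &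
    forall a b, - k <= a -> a <= b -> b <= k ->
      \int[mu]_(t in `]a, b]) (h t) = (phi b - phi a) + L * (b - a)].
Proof.
move=> L0 k0 phiL.
pose F (x : R) := phi x + L * x.
have FB s t : s <= t -> - (L * (t - s)) <= phi t - phi s <= L * (t - s).
  by move=> st; rewrite -ler_norml (le_trans (phiL _ _))// ger0_norm ?subr_ge0.
have Fnd : {homo F : x y / x <= y}.
  by move=> x y xy; rewrite /F; have /andP[+ _] := FB _ _ xy; lra.
have phic : continuous phi by exact: lipschitz_bound_continuous phiL.
have Fc : continuous F.
  move=> x; apply: cvgD; first exact: phic.
  exact: mulrl_continuous.
pose Fm := isCumulative.Build R _ R F Fnd (right_continuousW Fc).
pose Fcum : cumulative R R := HB.pack F Fm.
pose nuF := lebesgue_stieltjes_measure Fcum.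
pose I : set R := `](- k), k]%classic.
have mI : measurable (I : set (measurableTypeR R)).
  exact: measurable_itv.
have nuFoo : (nuF I < +oo)%E.
  have kk : - k <= k by lra.
  by rewrite [X in (X < _)%E](lebesgue_stieltjes_oc Fcum kk) ltry.
pose nu := mfrestr mI nuFoo.
have numu : nu `<< mu.
  apply/null_content_dominatesP => A mA A0; apply/eqP.
  rewrite eq_le measure_ge0 andbT /nu /mfrestr /mrestr.
  apply: (@le_trans _ _ ((2 * L)%:E * mu (A `&` I))%E).
    apply: lebesgue_stieltjes_le; [by lra| |exact: measurableI].
    by move=> s t st; rewrite /= /F; have /andP[_] := FB _ _ st; lra.
  rewrite (_ : mu _ = 0%E) ?mule0//; apply/eqP; rewrite eq_le measure_ge0 andbT.
  by rewrite -A0; apply: le_measure; rewrite ?inE//; exact: measurableI.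
have [f [f0 ffin intf fE]] := radon_nikodym_sigma_finite numu.
exists (fine \o f); split.
  by move=> t /=; rewrite fine_ge0.
  by rewrite [X in _.-integrable _ X](_ : _ = f)//; apply/funext => x /=; rewrite fineK.
move=> a b ka ab bk.
have mab : measurable (`]a, b]%classic : set (measurableTypeR R)).
  exact: measurable_itv.
rewrite /Rintegral.
under eq_integral do rewrite /= fineK//.
have := fE _ mab; rewrite /= => <-.
rewrite /nu /mfrestr /mrestr setIidl.
  by rewrite [X in fine X](lebesgue_stieltjes_oc Fcum ab)/= /F; ring.
by apply: subset_itv; rewrite bnd_simp.
Qed.


(** The first fundamental theorem of calculus identifies the density h almost
    everywhere with the derivative of phi + L id. *)
Lemma lipschitz_primitive_derive (phi : R -> R) (L k : R) : 0 <= L -> 0 < k ->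
  (forall s t, `|phi s - phi t| <= L * `|s - t|) ->
  exists h : R -> R, [/\ forall t, 0 <= h t, mu.-integrable setT (EFin \o h),
    forall a b, - k <= a -> a <= b -> b <= k ->
      \int[mu]_(t in `]a, b]) (h t) = (phi b - phi a) + L * (b - a) &
    {ae mu, forall t, - k < t < k -> is_derive t 1 phi (h t - L)}].
Proof.
move=> L0 k0 phiL; have [h [h0 inth hE]] := lipschitz_primitive L0 k0 phiL.
exists h; split => //.
have inthD A : measurable A -> mu.-integrable A (EFin \o h).
  by move=> mA; apply: integrableS inth.
have : locally_integrable setT h.
  by apply: open_integrable_locally => //; exact: openT.
move=> /(FTC1Ny (fun y => inthD _ (measurable_itv _))).
apply: ae_imply => t [dt Dt] /andP[kt tk].
pose F y := \int[mu]_(x in `]-oo, y]) (h x).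
have FD : is_derive t 1 F (h t).
  apply: DeriveDef; first exact: dt.
  exact: etrans (esym (derive1E F t)) Dt.
pose G y := F y + (phi (- k) - F (- k)) - L * (y + k).
apply: (@near_eq_is_derive _ _ _ G).
  near=> y.
  have ky : - k < y by near: y; apply: lt_nbhsr.
  have yk : y < k by near: y; apply: lt_nbhsl.
  have := hE (- k) y (lexx _) (ltW ky) (ltW yk).
  have := @Rintegral_itvB _ h (BInfty _ true) (BRight y) (- k)
    (inthD _ (measurable_itv _)) isT.
  rewrite bnd_simp => /(_ (ltW ky)); rewrite /G /F => <-.
  lra.
rewrite /G; apply: is_derive_eq.
by rewrite /GRing.scale/=; ring.
Unshelve. all: by end_near. Qed.

Lemma lipschitz_ae_derivable (phi : R -> R) (L : R) : 0 <= L ->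
  (forall s t, `|phi s - phi t| <= L * `|s - t|) ->
  {ae mu, forall t, derivable phi t 1}.
Proof.
move=> L0 phiL.
have : {ae mu, forall t, forall n : nat, - n.+1%:R < t < n.+1%:R -> derivable phi t 1}.
  apply/ae_foralln => n.
  have [h [_ _ _]] := lipschitz_primitive_derive L0 (ltr0Sn R n) phiL.
  by apply: ae_imply => t /[apply] -[].
apply: ae_imply => t /(_ (Num.bound `|t|)); apply.
by rewrite -ltr_norml (lt_trans (archi_boundP (normr_ge0 t)))// ltr_nat.
Qed.

(** This mean value inequality tolerates a null set of exceptional points, since
    phi is the integral of its derivative. *)
Lemma lipschitz_mean_value (phi : R -> R) (L c a b : R) : 0 <= L -> a <= b ->
  (forall s t, `|phi s - phi t| <= L * `|s - t|) ->
  {ae mu, forall t, a < t < b -> 'D_1 phi t <= c} ->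
  phi b - phi a <= c * (b - a).
Proof.
move=> L0 ab phiL' phic.
(* The larger Lipschitz constant makes c + M nonnegative, so that h is compared
   with a nonnegative constant. *)
pose M := L + `|c|.
have M0 : 0 <= M by rewrite addr_ge0.
have phiL s t : `|phi s - phi t| <= M * `|s - t|.
  by rewrite (le_trans (phiL' _ _))// ler_wpM2r// lerDl.
pose k := `|a| + `|b| + 1.
have k0 : 0 < k by rewrite ltr_wpDl.
have ka : - k < a.
  by rewrite /k; have := normr_ge0 b; have := ler_norm (- a); rewrite normrN; lra.
have bk : b < k by rewrite /k; have := normr_ge0 a; have := ler_norm b; lra.
have [h [h0 inth hE hD]] := lipschitz_primitive_derive M0 k0 phiL.
have := hE _ _ (ltW ka) ab (ltW bk).
have mab : measurable (`]a, b[%classic : set R) by exact: measurable_itv.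
rewrite -Rintegral_itv_bndo_bndc//; last exact: integrableS inth.
suff : \int[mu]_(t in `]a, b[) (h t) <= (c + M) * (b - a) by lra.
have -> : (c + M) * (b - a) = fine (\int[mu]_(t in `]a, b[) (c + M)%:E)%E.
  rewrite integral_cst//= lebesgue_measure_itv/= lte_fin.
  by case: ltP => //= ?; rewrite -?EFinB/=; congr (_ * _); lra.
rewrite /Rintegral fine_le//.
- exact/integrable_fin_num/(integrableS _ _ _ inth).
- by rewrite integral_cst//= lebesgue_measure_itv/=; case: ifP => //; rewrite mule0.
apply: ae_ge0_le_integral => //.
- by move=> t _; rewrite lee_fin.
- exact: (measurable_funS measurableT (@subsetT _ _) (measurable_int mu inth)).
- by move=> t _; rewrite lee_fin /M; have := ler_norm (- c); rewrite normrN; lra.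
move: phic hD; apply: ae_imply2 => t + + tab.
have {}tab : a < t < b by move: tab; rewrite /= in_itv.
move=> /(_ tab) Dc; have -> : - k < t < k by move: tab; lra.
by move=> /(_ isT)[_ /esym]; rewrite lee_fin; lra.
Qed.
End OneDim.

(** * Null sets of products and of the real line *)

Section ProductNull.
Local Open Scope ereal_scope.
Context d1 d2 (T1 : measurableType d1) (T2 : measurableType d2) (R : realType).
Variable m1 : {sigma_finite_measure set T1 -> \bar R}.
Variable m2 : {sigma_finite_measure set T2 -> \bar R}.

Lemma product_null_xsection (A : set (T1 * T2)) : measurable A ->
  (m1 \x m2) A = 0 <-> {ae m1, forall x, m2 (xsection A x) = 0}.
Proof.
move=> mA; rewrite /product_measure1.
have mf := measurable_fun_xsection m2 mA.
have -> : \int[m1]_x (m2 \o xsection A) x = \int[m1]_x `|(m2 \o xsection A) x|.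
  by apply: eq_integral => x _; rewrite gee0_abs.
split.
  move/(ae_eq_integral_abs m1 measurableT mf).
  by apply: ae_imply => x /(_ Logic.I).
move=> H; apply/(ae_eq_integral_abs m1 measurableT mf).
by move: H; apply: ae_imply => x.
Qed.

Lemma product_null_ysection (A : set (T1 * T2)) : measurable A ->
  (m1 \x m2) A = 0 <-> {ae m2, forall y, m1 (ysection A y) = 0}.
Proof.
move=> mA.
have -> : (m1 \x m2) A = (m1 \x^ m2) A.
  apply: (product_measure_unique (m' := m1 \x^ m2)) => // B C mB mC.
  exact: product_measure2E.
rewrite /product_measure2.
have mf := measurable_fun_ysection m1 mA.
have -> : \int[m2]_x (m1 \o ysection A) x = \int[m2]_x `|(m1 \o ysection A) x|.
  by apply: eq_integral => x _; rewrite gee0_abs.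
split.
  move/(ae_eq_integral_abs m2 measurableT mf).
  by apply: ae_imply => x /(_ Logic.I).
move=> H; apply/(ae_eq_integral_abs m2 measurableT mf).
by move: H; apply: ae_imply => x.
Qed.

End ProductNull.

Section Line.
Context {R : realType}.
Local Notation leb := (@lebesgue_measure R).
Local Notation gauss := (normal_prob (0 : R) 1).

Lemma lebesgue_null_shift (v : R) (A : set R) : measurable A ->
  leb A = 0%E -> leb ((fun t => t + v) @^-1` A) = 0%E.
Proof.
move=> mA A0.
pose sh : measurableTypeR R -> measurableTypeR R := fun t => t + v.
have ms : measurable_fun setT sh by apply: measurable_funD.
rewrite -[LHS]/(pushforward leb sh A) -A0; apply/esym.
apply: (lebesgue_measure_unique (mu := pushforward leb sh)) => // X.
move=> /ocitvP[->|[[a b]/= ab ->]].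
  by rewrite !measure0.
rewrite /pushforward /=.
have -> : sh @^-1` `]a, b]%classic = `](a - v), (b - v)]%classic.
  by apply/seteqP; split => t /=; rewrite !in_itv/= ltrBlDr lerBrDr.
by rewrite /lebesgue_measure !lebesgue_stieltjes_oc ?lerD2r ?ltW//=; congr EFin; ring.
Qed.

(** The Gaussian density is positive, so the Gaussian law has the same null sets
    as Lebesgue measure, while being a probability measure; finite products and
    images of it are then probability measures as well. *)
Lemma gauss_null (A : set (measurableTypeR R)) : measurable A ->
  gauss A = 0%E <-> leb A = 0%E.
Proof.
move=> mA; split; last first.
  by have /null_content_dominatesP := @normal_prob_dominates R 0 1; exact.
rewrite /normal_prob => A0.
have mT := measurable_int leb (integrable_normal_pdf (0 : R) 1).
have mf := measurable_funS measurableT (@subsetT _ A) mT.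
have : (\int[leb]_(x in A) `|(normal_pdf 0 1 x)%:E| = 0)%E.
  rewrite -[RHS]A0; apply: eq_integral => x _.
  by rewrite gee0_abs// lee_fin normal_pdf_ge0.
move/(ae_eq_integral_abs leb mA mf) => H.
apply/negligibleP => //.
apply: negligibleS H => x Ax /= /(_ Ax) /eqP; rewrite eqe.
rewrite /normal_pdf oner_eq0 mulf_eq0 => /orP[]; apply/negP; rewrite gt_eqF//.
  by apply: normal_peak_gt0; rewrite oner_eq0.
by rewrite /normal_fun expR_gt0.
Qed.

End Line.

(** * Borel sets of column vectors *)

Section MatrixNorm.
Context {R : realType} {m n : nat}.
Implicit Types A : 'M[R]_(m, n).

Lemma mx_norm_leP A (e : R) : 0 <= e -> `|A| <= e <-> forall i j, `|A i j| <= e.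
Proof.
move=> e0; rewrite [in X in X <-> _]/Num.norm /= mx_normrE; split.
  by move=> /bigmax_leP[_ /(_ _) H] i j; exact: (H (i, j)).
by move=> H; apply/bigmax_leP; split => // -[i j] _; exact: H.
Qed.

Lemma entry_le_norm A i j : `|A i j| <= `|A|.
Proof. exact: (mx_norm_leP A (normr_ge0 A)).1. Qed.

Lemma rat_mx_approx A (e : R) : 0 < e ->
  exists q : 'M[rat]_(m, n), `|A - map_mx ratr q| <= e.
Proof.
move=> e0.
have H i j : exists q : rat, `|A i j - ratr q| <= e.
  have /rat_in_itvoo[q] : A i j - e < A i j + e by lra.
  rewrite in_itv/= => /andP[q1 q2]; exists q.
  by rewrite ler_norml; lra.
exists (\matrix_(i, j) projT1 (cid (H i j))).
apply/(mx_norm_leP _ (ltW e0)) => i j; rewrite !mxE.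
exact: (projT2 (cid (H i j))).
Qed.

End MatrixNorm.

Section BorelVectors.
Context {R : realType}.

Definition borel_vec n := g_sigma_algebraType (@open 'cV[R]_n).

Lemma open_borel n (A : set 'cV[R]_n) : open A -> measurable (A : set (borel_vec n)).
Proof. by move=> oA; exact: sub_sigma_algebra. Qed.

Lemma closed_borel n (A : set 'cV[R]_n) : closed A -> measurable (A : set (borel_vec n)).
Proof.
move=> cA; rewrite -(setCK A); apply: measurableC.
apply: (@open_borel n (~` A)); exact: closed_openC.
Qed.

Lemma continuous_borel n (h : 'cV[R]_n -> R) : continuous h ->
  measurable_fun setT (h : borel_vec n -> measurableTypeR R).
Proof.
move=> /continuousP hc; apply: (measurability _ (RGenOpens.measurableE R)).
move=> _ [_ [a [b ->] <-]]; rewrite setTI; apply: open_borel.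
exact/hc/interval_open.
Qed.

Lemma measurable_entry n (i : 'I_n) :
  measurable_fun setT ((fun y => y i 0) : borel_vec n -> measurableTypeR R).
Proof. by apply: continuous_borel => y; exact: coord_continuous. Qed.

(** Balls of the sup norm are boxes, and each open set is a union of
    countably many balls with rational centres and radii.  Therefore the
    coordinates generate the Borel sigma-algebra. *)
Lemma measurable_vec d (T : measurableType d) n (F : T -> 'cV[R]_n) :
  (forall i, measurable_fun setT ((fun t => F t i 0) : T -> measurableTypeR R)) ->
  measurable_fun setT (F : T -> borel_vec n).
Proof.
move=> mF; apply: (@measurability _ _ T (borel_vec n) setT F (@open 'cV[R]_n)) => // _ [U oU <-].
rewrite setTI.
pose B (p : 'cV[rat]_n * nat) : set 'cV[R]_n :=
  [set y | `|y - map_mx ratr p.1| <= p.2.+1%:R^-1].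
have -> : F @^-1` U = \bigcup_p (if `[< B p `<=` U >] then F @^-1` B p else set0).
  apply/seteqP; split => t /=; last first.
    by move=> [p _]; case: asboolP => // BO; exact: BO.
  move=> UFt; move: oU; rewrite openE => /(_ _ UFt)/nbhs_ballP[e /= e0 eU].
  have e20 : 0 < e / 2 by lra.
  pose k := Num.bound (e / 2)^-1.
  have ke : k.+1%:R^-1 < e / 2 by exact: inv_bound_lt.
  have k0 : (0 : R) < k.+1%:R^-1 by rewrite invr_gt0.
  have [q qF] := rat_mx_approx (F t) k0.
  exists (q, k) => //; case: asboolP => // -[] z Bz; apply: eU.
  rewrite -ball_normE /=.
  have := ler_normD (F t - map_mx ratr q) (map_mx ratr q - z).
  rewrite subrKA -(normrN (map_mx _ _ - z)) opprB => /le_lt_trans; apply.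
  rewrite [ltRHS]splitr ltrD// (le_lt_trans _ ke)//.
apply: countable_bigcupT_measurable => [|p]; first exact: countableP.
case: asboolP => // _.
have -> : F @^-1` B p = \bigcap_(i in [set: 'I_n])
    [set t | `|F t i 0 - ratr (p.1 i 0)| <= p.2.+1%:R^-1].
  have k0 : (0 : R) <= p.2.+1%:R^-1 by rewrite invr_ge0.
  apply/seteqP; split => t /=.
    move=> /(mx_norm_leP _ k0) H i _ /=.
    by have := H i 0; rewrite !mxE.
  move=> H; apply/(mx_norm_leP _ k0) => i j; rewrite ord1 !mxE.
  exact: H.
apply: fin_bigcap_measurable => [|i _]; first exact: finite_finset.
have := mF i measurableT _ (measurable_itv
  `[ratr (p.1 i 0) - p.2.+1%:R^-1, ratr (p.1 i 0) + p.2.+1%:R^-1]).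
rewrite setTI; congr measurable.
by apply/seteqP; split => t /=; rewrite in_itv/= ler_distl.
Qed.

End BorelVectors.

(** * A quasi-invariant probability measure on column vectors *)

Section QuasiInvariant.
Context {R : realType}.
Local Notation leb := (@lebesgue_measure R).
Local Notation gauss := (normal_prob (0 : R) 1).
Local Notation borel_vec := (@borel_vec R).

Lemma measurable_addr n (v : 'cV[R]_n) :
  measurable_fun setT ((fun y => y + v) : borel_vec n -> borel_vec n).
Proof.
apply: measurable_vec => i.
rewrite (_ : (fun y : 'cV[R]_n => _) = (fun y => y i 0) \+ cst (v i 0)); last first.
  by apply/funext => z; rewrite mxE.
by apply: measurable_funD; [exact: measurable_entry|exact: measurable_cst].
Qed.

Definition quasi_invariant n (P : set (borel_vec n) -> \bar R) :=
  forall (v : 'cV[R]_n) (A : set (borel_vec n)), measurable A -> P A = 0%E ->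
    P ((fun y : 'cV[R]_n => y + v) @^-1` A) = 0%E.

Definition vcons n (p : measurableTypeR R * borel_vec n) : borel_vec n.+1 :=
  \col_i (if unlift ord0 i is Some j then (p.2 : 'cV[R]_n) j 0 else p.1).

Lemma measurable_vcons n : measurable_fun setT (@vcons n).
Proof.
apply: measurable_vec => i; rewrite /vcons.
under eq_fun do rewrite mxE.
case: unliftP => [j _|_]; last exact: measurable_fst.
exact: (measurableT_comp (measurable_entry j) measurable_snd).
Qed.

HB.instance Definition _ n :=
  @isMeasurableFun.Build _ _ _ _ (@vcons n) (@measurable_vcons n).

(** By induction on the dimension, each step adds one independent Gaussian
    coordinate.  If A is null, almost all its sections are null.  The sections of
    a translate of A are translates of sections of A, taken at shifted
    abscissas, so almost all of them are null again. *)
Lemma exists_quasi_invariant n :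
  exists P : probability (borel_vec n) R, quasi_invariant P.
Proof.
elim: n => [|n [P Pqi]].
  exists (@dirac _ (borel_vec 0) (0 : 'cV[R]_0) R) => v A mA.
  rewrite (_ : _ @^-1` A = A)//; apply/seteqP.
  by split => y; rewrite /preimage/= (_ : (y : 'cV[R]_0) + v = y)//; apply/colP => -[].
exists (distribution (gauss \x P)%E (@vcons n)) => v A mA.
have mA' : measurable (@vcons n @^-1` A).
  by rewrite -[X in measurable X]setTI; exact: measurable_vcons.
have mAv : measurable ((fun y : 'cV[R]_n.+1 => y + v) @^-1` A : set (borel_vec n.+1)).
  by rewrite -[X in measurable X]setTI; exact: measurable_addr.
have mAv' : measurable (@vcons n @^-1` ((fun y : 'cV[R]_n.+1 => y + v) @^-1` A)).
  by rewrite -[X in measurable X]setTI; exact: measurable_vcons.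
rewrite /distribution /pushforward.
move=> /(product_null_xsection gauss P mA').1 => H.
apply/(product_null_xsection gauss P mAv').2.
(* N is the null set of abscissas at which the section of A is not null. *)
pose N := [set t : measurableTypeR R | P (xsection (@vcons n @^-1` A) t) <> 0%E].
have [M [mM M0 NM]] : leb.-negligible N.
  case: H => M [mM M0 NM]; exists M; split => //.
  exact/(gauss_null mM).1.
exists ((fun t : R => t + v ord0 0) @^-1` M); split.
- rewrite -[X in measurable X]setTI.
  apply: (measurable_funD (D := setT) (f := id) (g := cst (v ord0 0))) => //.
- apply/(gauss_null _).2; last exact: lebesgue_null_shift.
  rewrite -[X in measurable X]setTI.
  apply: (measurable_funD (D := setT) (f := id) (g := cst (v ord0 0))) => //.
move=> t /= nt; apply: NM => tN; apply: nt.
pose w : 'cV[R]_n := \col_j v (lift ord0 j) 0.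
have mx : measurable (xsection (@vcons n @^-1` A) (t + v ord0 0)).
  exact: measurable_xsection.
rewrite -[RHS](Pqi w _ mx tN); congr (P _).
have vE (y : 'cV[R]_n) : vcons (t, y) + v = vcons (t + v ord0 0, y + w) :> 'cV[R]_n.+1.
  apply/colP => i; rewrite !mxE; case: unliftP => [j ->|->] //=.
  by rewrite !mxE.
by apply/seteqP; split => y; rewrite /xsection /= !inE /= vE.
Qed.

Section Consequences.
Context {n : nat} {P : probability (borel_vec n) R}.
Hypothesis Pqi : quasi_invariant P.

Lemma measurable_line (v : 'cV[R]_n) : measurable_fun setT
  ((fun p => (p.1 : 'cV[R]_n) + p.2 *: v) : borel_vec n * measurableTypeR R -> borel_vec n).
Proof.
apply: measurable_vec => i.
rewrite (_ : (fun p => _) = (fun p : borel_vec n * measurableTypeR R =>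
  (p.1 : 'cV[R]_n) i 0) \+ (fun p => p.2 * v i 0)); last first.
  by apply/funext => z; rewrite !mxE.
apply: measurable_funD.
  exact: (measurableT_comp (measurable_entry i) measurable_fst).
apply: measurable_funM; last exact: measurable_cst.
exact: measurable_snd.
Qed.

(** By Fubini's theorem, A - t v is null for almost every t.  One such t is
    enough, by quasi-invariance. *)
Lemma null_of_lines (v : 'cV[R]_n) (A : set (borel_vec n)) : measurable A ->
  (forall y : 'cV[R]_n, {ae leb, forall t, ~ A (y + t *: v)}) -> P A = 0%E.
Proof.
move=> mA Av.
pose S := (fun p : borel_vec n * measurableTypeR R => (p.1 : 'cV[R]_n) + p.2 *: v) @^-1` A.
have mS : measurable S by rewrite -[X in measurable X]setTI; exact: measurable_line.
have : (P \x gauss)%E S = 0%E.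
  apply/(product_null_xsection P gauss mS).2; apply: aeW => y.
  have mx := @measurable_xsection _ _ _ _ S y mS.
  apply/(gauss_null mx).2/negligibleP => //; have := Av y.
  by apply: negligibleS => t; rewrite /xsection/= inE => At; apply.
move=> /(product_null_ysection P gauss mS).1 => -[N [mN N0 NS]].
have [t Nt] := probability_null_compl N0.
have tS : P (ysection S t) = 0%E by apply: contrapT => h; apply: Nt; apply: NS.
have := Pqi (- (t *: v)) (measurable_ysection t mS) tS.
move=> <-; congr (P _); apply/seteqP; split => y; rewrite /ysection/= inE /S/= subrK //.
Qed.

(** Each A - t v is null by quasi-invariance, so Fubini's theorem applies in
    the other order. *)
Lemma lines_of_null (v : 'cV[R]_n) (A : set (borel_vec n)) : P.-negligible A ->
  {ae P, forall y : 'cV[R]_n, {ae leb, forall t, ~ A (y + t *: v)}}.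
Proof.
move=> [B [mB B0 AB]].
pose S := (fun p : borel_vec n * measurableTypeR R => (p.1 : 'cV[R]_n) + p.2 *: v) @^-1` B.
have mS : measurable S by rewrite -[X in measurable X]setTI; exact: measurable_line.
have : (P \x gauss)%E S = 0%E.
  apply/(product_null_ysection P gauss mS).2; apply: aeW => t.
  rewrite -[RHS](Pqi (t *: v) mB B0); congr (P _).
  by apply/seteqP; split => y; rewrite /ysection/= inE.
move=> /(product_null_xsection P gauss mS).1; apply: ae_imply => y.
have mx := @measurable_xsection _ _ _ _ S y mS.
move=> /(gauss_null mx).1 S0; exists (xsection S y); split => //.
by move=> t /= /contrapT /AB; rewrite /xsection/= inE.
Qed.

(** A null nonempty open set would have null rational translates.  They cover
    the whole space, which is not null. *)
Lemma ae_dense (A : set 'cV[R]_n) : {ae P, forall y, A y} -> dense A.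
Proof.
move=> aeA U [x Ux] oU.
apply: contrapT => UA.
have U0 : P (U : set (borel_vec n)) = 0%E.
  apply/negligibleP; first exact: open_borel.
  apply: negligibleS aeA => y Uy Ay; apply: UA; by exists y.
have aeN (q : 'cV[rat]_n) :
    {ae P, forall y : 'cV[R]_n, ~ U (y + map_mx ratr q)}.
  exists ((fun y : 'cV[R]_n => y + map_mx ratr q) @^-1` U); split.
  - rewrite -[X in measurable X]setTI; apply: measurable_addr => //.
    exact: open_borel.
  - by apply: Pqi => //; exact: open_borel.
  - by move=> y /= /contrapT.
have [N [mN N0 NS]] := ae_forall_countable aeN.
have [z Nz] := probability_null_compl N0.
apply: Nz; apply: NS => /= /(_ _) zU.
move: oU; rewrite openE => /(_ _ Ux)/nbhs_ballP[e /= e0 eU].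
have e20 : 0 < e / 2 by lra.
have [q qE] := rat_mx_approx (x - z) e20.
apply: (zU q); apply: eU; rewrite -ball_normE /= opprD addrA.
by rewrite (le_lt_trans qE)//; lra.
Qed.

End Consequences.
End QuasiInvariant.

(** * Differentiability, the inner product and the distance to a set *)

Section EpsilonDifferential.
Context {R : realType} {V W : normedModType R}.

Lemma differentiable_eps (f : V -> W) (x : V) (df : {linear V -> W}) :
  continuous df ->
  (forall e, 0 < e -> exists2 d, 0 < d &
    forall h, `|h| <= d -> `|f (x + h) - f x - df h| <= e * `|h|) ->
  differentiable f x /\ 'd f x = df :> (V -> W).
Proof.
move=> dfc H.
have fE : f \o shift x = cst (f x) + df +o_ 0 id.
  apply/eqaddoP => e e0; have [d d0 dH] := H e e0.
  apply/nbhs_ballP; exists d => //= h; rewrite -ball_normE /= sub0r normrN => hd.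
  have := dH h (ltW hd); rewrite !fctE /= opprD addrA (addrC h).
  exact.
have dE := diff_unique dfc fE.
by split => //; apply/diff_locallyP; rewrite dE.
Qed.

Lemma eps_differentiable (f : V -> W) (x : V) : differentiable f x ->
  forall e, 0 < e -> exists2 d, 0 < d &
    forall h, `|h| <= d -> `|f (x + h) - f x - 'd f x h| <= e * `|h|.
Proof.
move=> /diff_locallyP[_ /eqaddoP fE] e e0.
have /nbhs_ballP[d /= d0 dH] := fE e e0.
exists (d / 2) => [|h hd]; first by rewrite divr_gt0.
have := dH h; rewrite -ball_normE /= sub0r normrN !fctE /= opprD addrA (addrC h).
by apply; rewrite (le_lt_trans hd)// ltr_pdivrMr// ltr_pMr// ltr1n.
Qed.

End EpsilonDifferential.

Section Inner.
Context {R : realType} {n : nat}.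
Implicit Types a b h v : 'cV[R]_n.

Lemma inner_is_linear a : linear (inner a : 'cV[R]_n -> R).
Proof.
move=> k u v; rewrite /inner scaler_sumr -big_split /=; apply: eq_bigr => i _.
by rewrite !mxE mulrDr mulrCA.
Qed.

HB.instance Definition _ a :=
  GRing.isLinear.Build R 'cV[R]_n R _ (inner a) (inner_is_linear a).

Lemma innerC a b : inner a b = inner b a.
Proof. by apply: eq_bigr => i _; rewrite mulrC. Qed.

Lemma innerDl a b h : inner (a + b) h = inner a h + inner b h.
Proof. by rewrite innerC linearD/= !(innerC h). Qed.

Lemma innerBl a b h : inner (a - b) h = inner a h - inner b h.
Proof. by rewrite innerC linearB/= !(innerC h). Qed.

Lemma innerZl k a h : inner (k *: a) h = k * inner a h.
Proof. by rewrite innerC linearZ/= innerC. Qed.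

Lemma innerDr h a b : inner h (a + b) = inner h a + inner h b.
Proof. exact: linearD. Qed.

Lemma innerBr h a b : inner h (a - b) = inner h a - inner h b.
Proof. exact: linearB. Qed.

Lemma innerZr k h a : inner h (k *: a) = k * inner h a.
Proof. exact: linearZ. Qed.

Lemma inner_delta a (i : 'I_n) : inner a (delta_mx i 0) = a i 0.
Proof.
rewrite /inner (bigD1 i)//= mxE !eqxx mulr1 big1 ?addr0// => j /negbTE ji.
by rewrite mxE ji mulr0.
Qed.

Lemma inner_le a b : `|inner a b| <= n%:R * `|a| * `|b|.
Proof.
rewrite (le_trans (ler_norm_sum _ _ _))//.
rewrite -mulrA -[n in n%:R]card_ord mulr_natl -sumr_const.
by apply: ler_sum => i _; rewrite normrM ler_pM// entry_le_norm.
Qed.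

Lemma inner_continuous a : continuous (inner a).
Proof.
apply: (@lipschitz_bound_continuous _ _ _ _ (n%:R * `|a|)) => x y.
by rewrite -linearB/= inner_le.
Qed.

End Inner.

Section DistanceToSet.
Context {R : realType} {V : normedModType R}.
Implicit Types (E : set V) (y z : V).

Definition set_dist E y : R := inf [set `|y - z| | z in E].

Lemma set_dist_ge0 E y : 0 <= set_dist E y.
Proof.
have [->|/set0P[z Ez]] := eqVneq E set0; first by rewrite /set_dist image_set0 inf0.
by apply: lb_le_inf => [|_ [z' _ <-]//]; exists `|y - z|, z.
Qed.

Lemma set_dist_le E y z : E z -> set_dist E y <= `|y - z|.
Proof.
by move=> Ez; apply: ge_inf; [exists 0 => _ [z' _ <-]|exists z].
Qed.

Lemma set_dist_mem E y : E y -> set_dist E y = 0.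
Proof.
move=> Ey; apply/eqP; rewrite eq_le set_dist_ge0 andbT.
by rewrite (le_trans (set_dist_le _ Ey))// subrr normr0.
Qed.

Lemma set_dist_lt E y (r : R) : E !=set0 -> set_dist E y < r ->
  exists2 z, E z & `|y - z| < r.
Proof.
move=> [z0 Ez0] /inf_lt[]; first by exists `|y - z0|, z0.
by move=> _ [z Ez <-] yz; exists z.
Qed.

Lemma set_dist_lipschitz E y y' : `|set_dist E y - set_dist E y'| <= `|y - y'|.
Proof.
have [->|E0] := eqVneq E set0.
  by rewrite /set_dist !image_set0 subrr normr0.
move/set0P: E0 => E0.
suff H u v : set_dist E u - set_dist E v <= `|u - v|.
  by rewrite ler_norml H andbT lerNl opprB -(normrN (y - _)) opprB H.
apply/ler_addgt0Pr => e e0.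
have ve : set_dist E v < set_dist E v + e by rewrite ltrDl.
have [z Ez vz] := set_dist_lt E0 ve.
have := ler_normD (u - v) (v - z); rewrite subrKA => H.
have := set_dist_le u Ez; lra.
Qed.

End DistanceToSet.

(** * Rademacher's theorem *)

Lemma closed_increment_le {R : realType} {V : normedModType R} (g : V -> R)
    (h : V) (c b : R) : continuous g ->
  closed [set y | `|g (y + h) - g y - c| <= b].
Proof.
move=> gc; apply: (preimage_closed (D := [set r : R | r <= b])
  (f := fun y => `|g (y + h) - g y - c|)); last exact: closed_le.
move=> y _; apply: cvg_norm; apply: cvgB; last exact: cvg_cst.
apply: cvgB; last exact: gc.
apply: (cvg_comp (fun y => y + h) g); last exact: gc.
by apply: cvgD; [exact: cvg_id|exact: cvg_cst].
Qed.

Section Rademacher.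
Context {R : realType} {n : nat}.
Local Notation leb := (@lebesgue_measure R).
Local Notation vec := 'cV[R]_n.
Implicit Types (g : vec -> R) (V : set vec).

Definition affine_within g V (a : vec) (d e : R) : set vec :=
  [set y | forall h, V h -> `|h| <= d -> `|g (y + h) - g y - inner a h| <= e * `|h|].

(** The slope a may depend on e.  In this form, differentiability along V amounts
    to membership in countably many closed sets, see [differentiable_along_rat];
    that the slopes converge is shown in [differentiable_along_setT]. *)
Definition differentiable_along g V (y : vec) :=
  forall e, 0 < e -> exists a, exists2 d, 0 < d & affine_within g V a d e y.

Lemma affine_within_closed g V a d e : continuous g -> closed (affine_within g V a d e).
Proof.
move=> gc.
have -> : affine_within g V a d e =
  \bigcap_(h in [set h | V h /\ `|h| <= d])
    [set y | `|g (y + h) - g y - inner a h| <= e * `|h|].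
  apply/seteqP; split => [y yH h [Vh hd]|y yH h Vh hd]; first exact: yH.
  exact: (yH h).
apply: closed_bigI => h _.
exact: closed_increment_le.
Qed.

(** Rational slopes and inverse integers suffice, which makes the set of points
    of differentiability along V a Borel set. *)
Lemma differentiable_along_rat g V y : differentiable_along g V y <->
  forall m, exists p : 'cV[rat]_n * nat,
    affine_within g V (map_mx ratr p.1) p.2.+1%:R^-1 m.+1%:R^-1 y.
Proof.
split=> [yD m|yD e e0].
  pose e : R := m.+1%:R^-1.
  have e20 : 0 < e / 2 by rewrite divr_gt0// invr_gt0.
  have [a [d d0 H]] := yD _ e20.
  have c0 : 0 < (e / 2) / (n%:R + 1) by rewrite divr_gt0// ltr_wpDl.
  have [q qa] := rat_mx_approx a c0.
  exists (q, Num.bound d^-1) => h Vh /= hd.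
  have {}hd : `|h| <= d.
    exact: le_trans hd (ltW (inv_bound_lt d0)).
  have := H h Vh hd; rewrite -/e.
  have -> : g (y + h) - g y - inner (map_mx ratr q) h =
    (g (y + h) - g y - inner a h) + inner (a - map_mx ratr q) h.
    by rewrite innerBl; ring.
  move=> H1; rewrite (le_trans (ler_normD _ _))//.
  rewrite [e in leRHS]splitr mulrDl lerD// (le_trans (inner_le _ _))//.
  rewrite ler_wpM2r// (@le_trans _ _ ((n%:R + 1) * `|a - map_mx ratr q|))//.
    by rewrite ler_wpM2r// lerDl.
  by rewrite -ler_pdivlMl ?ltr_wpDl// mulrC.
have [[q k] H] := yD (Num.bound e^-1).
exists (map_mx ratr q); exists k.+1%:R^-1; first by rewrite invr_gt0.
move=> h Vh hd; rewrite (le_trans (H h Vh hd))// ler_wpM2r//.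
exact/ltW/inv_bound_lt.
Qed.

Lemma differentiable_along_borel g V : continuous g ->
  measurable ([set y | differentiable_along g V y] : set (@borel_vec R n)).
Proof.
move=> gc.
have -> : [set y | differentiable_along g V y] =
    \bigcap_m \bigcup_(p : 'cV[rat]_n * nat)
      affine_within g V (map_mx ratr p.1) p.2.+1%:R^-1 m.+1%:R^-1.
  apply/seteqP; split => y /=.
    by move=> /differentiable_along_rat H m _; have [p] := H m; exists p.
  move=> H; apply/differentiable_along_rat => m; have [p _] := H m Logic.I.
  by exists p.
apply: bigcapT_measurable => m; apply: countable_bigcupT_measurable => [|p].
  exact: countableP.
by apply: closed_borel; exact: affine_within_closed.
Qed.

Context {P : probability (@borel_vec R n) R} (Pqi : quasi_invariant P).

(** The exceptional set is Borel and, by the one-dimensional theorem, null on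
    each line with direction v. *)
Lemma ae_differentiable_along_line g (L : R) (v : vec) : 0 <= L ->
  (forall x y, `|g x - g y| <= L * `|x - y|) ->
  {ae P, forall y, differentiable_along g (range (fun t : R => t *: v)) y}.
Proof.
move=> L0 gL.
pose D : set vec := [set y | differentiable_along g (range (fun t : R => t *: v)) y].
have gc : continuous g by apply: lipschitz_bound_continuous gL.
have mD : measurable (D : set (@borel_vec R n)) by exact: differentiable_along_borel.
have mCD : measurable (~` D : set (@borel_vec R n)) by exact: measurableC.
apply/(negligibleP _ mCD); apply: (null_of_lines Pqi (v := v)) => // y.
pose phi (t : R) := g (y + t *: v).
have phiL s t : `|phi s - phi t| <= (L * `|v|) * `|s - t|.
  rewrite (le_trans (gL _ _))// opprD addrACA subrr add0r -scalerBl normrZ.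
  by rewrite -mulrA (mulrC `|v|).
have Lv0 : 0 <= L * `|v| by rewrite mulr_ge0.
have := lipschitz_ae_derivable Lv0 phiL.
apply: ae_imply => t dt; apply => e e0.
have [v0|v0] := eqVneq v 0.
  exists 0; exists 1 => // h [s _ <-] _.
  by rewrite v0 !scaler0 !addr0 subrr linear0 subrr !normr0 mulr0.
have /cV0Pn[i vi] := v0.
have vn0 : 0 < `|v| by rewrite normr_gt0.
have e'0 : 0 < e * `|v| by rewrite mulr_gt0.
have dphi : differentiable phi t by apply/derivable1_diffP.
have [d d0 H] := eps_differentiable dphi e'0.
(* Any a with <a, v> = phi'(t) works; this one has a single nonzero entry. *)
exists ('D_1 phi t / v i 0 *: delta_mx i 0); exists (d * `|v|); first by rewrite mulr_gt0.
move=> _ [s _ <-]; rewrite normrZ => sd.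
have {}sd : `|s| <= d by rewrite -(ler_pM2r vn0).
have := H s sd.
have -> : 'd phi t s = s * 'D_1 phi t.
  by rewrite deriveE// -[X in 'd phi t X]mulr1 -[X in 'd phi t X]/(s *: (1 : R)) linearZ.
have -> : inner ('D_1 phi t / v i 0 *: delta_mx i 0) (s *: v) = s * 'D_1 phi t.
  by rewrite innerZl innerC inner_delta mxE; field.
by rewrite /phi scalerDl addrA (mulrC `|s|) mulrA.
Qed.

Definition coord_subspace (j : nat) : set vec :=
  [set h | forall i : 'I_n, (j <= i)%N -> h i 0 = 0].

(** The distance to E is nonnegative and vanishes at y, so its derivative at y is
    zero in the direction v: y + t v is at distance o(t) from E. *)
Lemma set_dist_differentiable_along E (v y : vec) :
  E y -> differentiable_along (set_dist E) (range (fun t : R => t *: v)) y ->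
  forall e, 0 < e -> exists2 d, 0 < d & forall t, `|t *: v| <= d ->
    exists2 z, E z & `|y + t *: v - z| <= e * `|t *: v|.
Proof.
move=> Ey yD e e0; have e30 : 0 < e / 3 by rewrite divr_gt0.
have [a [d d0 H]] := yD _ e30.
exists d => // t td.
have [->|tv0] := eqVneq (t *: v) 0.
  by exists y => //; rewrite addr0 subrr normr0 mulr0.
have n0 : 0 < `|t *: v| by rewrite normr_gt0.
have := H _ (imageT _ t) td.
have := H _ (imageT _ (- t)); rewrite scaleNr normrN => /(_ td).
have iN : inner a (- (t *: v)) = - inner a (t *: v) by exact: linearN.
(* The linear terms of the increments at t and at - t cancel. *)
rewrite iN (set_dist_mem Ey) !subr0 opprK.
set r := inner a _; set D' := set_dist E _; set D := set_dist E _.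
move=> H1 H2.
have D'0 : 0 <= D' by exact: set_dist_ge0.
have [//||z Ez zE] := @set_dist_lt _ _ E (y + t *: v) (e * `|t *: v|).
- by exists y.
- rewrite -/D; move: H1 H2; rewrite !ler_norml => /andP[_ H1] /andP[_ H2].
  have : 0 < e * `|t *: v| by rewrite mulr_gt0.
  by move: H1 H2; lra.
by exists z => //; exact: ltW.
Qed.

(** For h = v + h' with v on the j-th axis and h' in the subspace of the first j
    coordinates, replace y + v by a point z of E at distance o(|v|).  The
    increment of g from z to z + h' is controlled because z is in E, the one from
    y to y + v because g is differentiable along the axis, and the replacement
    costs at most 2 L |y + v - z|. *)
Lemma differentiable_along_extend g (L : R) (j : 'I_n) y : 0 <= L ->
  (forall x y, `|g x - g y| <= L * `|x - y|) ->
  differentiable_along g (range (fun t : R => t *: delta_mx j 0)) y ->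
  differentiable_along g (coord_subspace j) y ->
  (forall (p : 'cV[rat]_n * nat) (m : nat), let E := affine_within g (coord_subspace j)
      (map_mx ratr p.1) p.2.+1%:R^-1 m.+1%:R^-1 in
     differentiable_along (set_dist E) (range (fun t : R => t *: delta_mx j 0)) y) ->
  differentiable_along g (coord_subspace j.+1) y.
Proof.
move=> L0 gL yj yV yE e e0.
(* The four error terms are L eta |h|, eta |h|, L eta |h| and eta |h|. *)
pose C := 2 * L + 2.
have C0 : 0 < C by rewrite /C; lra.
pose m := Num.bound (e / C)^-1.
pose eta : R := m.+1%:R^-1.
have eta0 : 0 < eta by rewrite invr_gt0.
have etae : C * eta <= e.
  by rewrite -ler_pdivlMl// mulrC; apply/ltW/inv_bound_lt; rewrite divr_gt0.
have /differentiable_along_rat/(_ m)[[q k] yq] := yV.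
set E := affine_within _ _ _ _ _ in yq.
have [d1 d10 H1] := set_dist_differentiable_along yq (yE (q, k) m) eta0.
have [b [d2 d20 H2]] := yj _ eta0.
pose a : vec := \col_i (if i == j then b j 0 else ratr (q i 0)).
pose d3 : R := k.+1%:R^-1.
have d30 : 0 < d3 by rewrite invr_gt0.
exists a; exists (Num.min d1 (Num.min d2 d3)); first by rewrite !lt_min d10 d20.
move=> h Vh; rewrite !le_min => /and3P[hd1 hd2 hd3].
pose t := h j 0; pose v := t *: (delta_mx j 0 : vec).
pose h' := h - v.
have hE : h = v + h' by rewrite /h' addrC subrK.
have h'E i : h' i 0 = if i == j then 0 else h i 0.
  rewrite /h' /v /t !mxE eqxx andbT; case: eqP => [->|_].
    by rewrite mulr1 subrr.
  by rewrite mulr0 subr0.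
have vE i : v i 0 = if i == j then h j 0 else 0.
  by rewrite /v /t !mxE eqxx andbT; case: eqP => _; rewrite (mulr1, mulr0).
have h'h : `|h'| <= `|h|.
  apply/mx_norm_leP => // i l; rewrite ord1 h'E; case: eqP => _.
    by rewrite normr0.
  exact: entry_le_norm.
have vh : `|v| <= `|h|.
  apply/mx_norm_leP => // i l; rewrite ord1 vE; case: eqP => _.
    exact: entry_le_norm.
  by rewrite normr0.
have Vh' : coord_subspace j h'.
  move=> i ji; rewrite h'E; case: eqP => // /eqP ij; apply: Vh.
  by rewrite ltn_neqAle ji andbT eq_sym.
have aE : inner a h = inner (map_mx ratr q) h' + inner b v.
  rewrite /inner -big_split/=; apply: eq_bigr => i _.
  by rewrite h'E vE !mxE; case: eqP => [->|_]; rewrite mulr0 ?add0r ?addr0.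
have [z Ez zy] := H1 t (le_trans vh hd1).
have zN : L * `|y + v - z| <= L * (eta * `|h|).
  by rewrite ler_wpM2l// (le_trans zy)// ler_wpM2l// ltW.
have n1 : `|g (y + h) - g (z + h')| <= L * (eta * `|h|).
  rewrite (le_trans (gL _ _))// (_ : y + h - (z + h') = y + v - z)//.
  by rewrite hE addrA opprD addrACA subrr addr0.
have n2 : `|g (z + h') - g z - inner (map_mx ratr q) h'| <= eta * `|h|.
  by rewrite (le_trans (Ez h' Vh' (le_trans h'h hd3)))// ler_wpM2l// ltW.
have n3 : `|g z - g (y + v)| <= L * (eta * `|h|).
  by rewrite (le_trans (gL _ _))// -normrN opprB.
have n4 : `|g (y + v) - g y - inner b v| <= eta * `|h|.
  by rewrite (le_trans (H2 v (imageT _ t) (le_trans vh hd2)))// ler_wpM2l// ltW.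
rewrite aE (_ : g (y + h) - g y - _ = (g (y + h) - g (z + h')) +
  (g (z + h') - g z - inner (map_mx ratr q) h') + (g z - g (y + v)) +
  (g (y + v) - g y - inner b v)); last by ring.
rewrite (@le_trans _ _ ((C * eta) * `|h|))//; last by rewrite ler_wpM2r.
have -> : C * eta * `|h| = L * (eta * `|h|) + eta * `|h| + L * (eta * `|h|) + eta * `|h|.
  by rewrite /C; ring.
do 3 (rewrite (le_trans (ler_normD _ _))// lerD//).
Qed.

(** Two slopes a m and a p, with tolerances 1/(m+1) and 1/(p+1), differ in each
    coordinate by at most the sum of the tolerances.  So all the intervals of
    radius 1/(m+1) around the coordinates of a m have a common point, the
    supremum of their left ends. *)
Lemma differentiable_along_setT g y : differentiable_along g setT y -> differentiable g y.
Proof.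
move=> yD.
have eps0 m : 0 < m.+1%:R^-1 :> R by rewrite invr_gt0.
pose a m : vec := projT1 (cid (yD _ (eps0 m))).
have aP m : exists2 d, 0 < d & affine_within g setT (a m) d m.+1%:R^-1 y.
  exact: (projT2 (cid (yD _ (eps0 m)))).
have aC i m p : a m i 0 - m.+1%:R^-1 <= a p i 0 + p.+1%:R^-1.
  have [d d0 H] := aP m; have [d' d'0 H'] := aP p.
  pose t := Num.min d d'.
  have t0 : 0 < t by rewrite lt_min d0.
  pose h : vec := t *: delta_mx i 0.
  have hn : `|h| <= t.
    apply/mx_norm_leP => [|k l]; first exact: ltW.
    rewrite !mxE ord1 eqxx andbT normrM gtr0_norm//.
    by case: (k == i); rewrite ?normr1 ?normr0 ?mulr1 ?mulr0 ?lexx // ltW.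
  have := H h Logic.I (le_trans hn _); rewrite ge_min lexx => /(_ isT).
  have := H' h Logic.I (le_trans hn _); rewrite ge_min lexx orbT => /(_ isT).
  have hE u : inner u h = t * u i 0 by rewrite /h linearZ/= inner_delta.
  rewrite !hE.
  have e1 : m.+1%:R^-1 * `|h| <= m.+1%:R^-1 * t by rewrite ler_wpM2l// ltW.
  have e2 : p.+1%:R^-1 * `|h| <= p.+1%:R^-1 * t by rewrite ler_wpM2l// ltW.
  rewrite !ler_norml => /andP[h1 h2] /andP[h3 h4].
  rewrite -(ler_pM2r t0); move: h1 h2 h3 h4 e1 e2.
  move: (m.+1%:R^-1) (p.+1%:R^-1) (`|h|) (g (y + h) - g y) (a m i 0) (a p i 0).
  move=> M Q N X A B; clearbody t.
  lra.
pose b : vec := \col_i sup [set a m i 0 - m.+1%:R^-1 | m in [set: nat]].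
have bP i m : `|a m i 0 - b i 0| <= m.+1%:R^-1.
  have ub k : ubound [set a m i 0 - m.+1%:R^-1 | m in [set: nat]] (a k i 0 + k.+1%:R^-1).
    by move=> _ [p _ <-]; exact: aC.
  have b1 : b i 0 <= a m i 0 + m.+1%:R^-1.
    rewrite mxE; apply: ge_sup; last exact: ub.
    by exists (a m i 0 - m.+1%:R^-1); exists m.
  have b2 : a m i 0 - m.+1%:R^-1 <= b i 0.
    rewrite mxE; apply: ub_le_sup; last by exists m.
    by exists (a m i 0 + m.+1%:R^-1); exact: ub.
  by rewrite ler_distl lerBlDr b1 -lerBlDr b2.
apply: (proj1 (@differentiable_eps _ _ _ g y (inner b) (@inner_continuous _ _ b) _)) => e e0.
pose m := Num.bound (e / (n%:R + 1))^-1.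
have n10 : 0 < n%:R + 1 :> R by rewrite ltr_wpDl.
have me : (n%:R + 1) * m.+1%:R^-1 <= e.
  by rewrite -ler_pdivlMl// mulrC; apply/ltW/inv_bound_lt; rewrite divr_gt0.
have [d d0 H] := aP m; exists d => // h hd.
have := H h Logic.I hd => H1.
rewrite (_ : _ - _ - _ = (g (y + h) - g y - inner (a m) h) + inner (a m - b) h); last first.
  by rewrite innerBl; ring.
rewrite (le_trans (ler_normD _ _))// (@le_trans _ _ ((n%:R + 1) * m.+1%:R^-1 * `|h|))//; last first.
  by rewrite ler_wpM2r.
rewrite mulrDl mul1r mulrDl addrC lerD// (le_trans (inner_le _ _))//.
rewrite ler_wpM2r// ler_wpM2l//; apply/mx_norm_leP => [|i l]; first exact: ltW.
by rewrite ord1 !mxE; have := bP i m; rewrite mxE.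
Qed.

(** Countably many sets E occur, one for each rational slope, radius and
    tolerance, so that almost every y is suitable for all of them at once. *)
Theorem lipschitz_ae_differentiable g (L : R) : 0 <= L ->
  (forall x y, `|g x - g y| <= L * `|x - y|) ->
  {ae P, forall y : vec, differentiable g y}.
Proof.
move=> L0 gL.
suff H j : (j <= n)%N -> {ae P, forall y, differentiable_along g (coord_subspace j) y}.
  have := H n (leqnn n); apply: ae_imply => y yD; apply: differentiable_along_setT.
  move=> e /yD[a [d d0 yd]]; exists a; exists d => // h _; apply: yd => i.
  by rewrite leqNgt ltn_ord.
elim: j => [_|j IH jn].
  apply: aeW => y e e0; exists 0; exists 1 => // h h0 _.
  have -> : h = 0 by apply/colP => i; rewrite mxE h0.
  by rewrite addr0 subrr linear0 subrr !normr0 mulr0.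
pose j' := Ordinal jn.
have L1 := ae_differentiable_along_line (delta_mx j' 0) L0 gL.
have L2 : {ae P, forall y, forall (p : 'cV[rat]_n * nat) (m : nat),
    let E := affine_within g (coord_subspace j')
      (map_mx ratr p.1) p.2.+1%:R^-1 m.+1%:R^-1 in
    differentiable_along (set_dist E) (range (fun t : R => t *: delta_mx j' 0)) y}.
  apply: ae_forall_countable => p; apply: ae_forall_countable => m /=.
  apply: ae_differentiable_along_line ler01 _ => u v; rewrite mul1r.
  exact: set_dist_lipschitz.
move: L1 (IH (ltnW jn)) => L1 L3.
apply: ae_imply2 L1 (ae_imply2 _ L2 L3) => [y|y y2 y3]; last exact: (conj y2 y3).
by move=> y1 [y2 y3]; exact: (differentiable_along_extend (j := j') L0 gL y1 y3 y2).
Qed.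

End Rademacher.

(** * Gradients and Hessians *)

Section Calculus.
Context {R : realType}.

Lemma is_derive_along_line {V : normedModType R} (f : V -> R) (p a : V) (s : R) :
  differentiable f (p + s *: a) ->
  is_derive s 1 (fun s => f (p + s *: a)) ('d f (p + s *: a) a).
Proof.
move=> df.
have dl : is_diff s (fun s => p + s *: a) ( *:%R ^~ a).
  have := is_diffD (is_diff_cst p s) (is_diff_scalel s a).
  by rewrite add0r.
have dfs : differentiable (f \o (fun s => p + s *: a)) s.
  by apply: differentiable_comp => //; exact: ex_diff.
apply: DeriveDef; first exact/diff_derivable.
by rewrite deriveE// diff_comp//= diff_val scale1r.
Qed.

Context {n : nat}.
Local Notation vec := 'cV[R]_n.
Implicit Types (f g : vec -> R) (G : vec -> vec).

Lemma vec_sum_delta (h : vec) : h = \sum_i h i 0 *: delta_mx i 0.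
Proof.
apply/colP => i; rewrite summxE (bigD1 i)//= !mxE !eqxx mulr1 big1 ?addr0// => j ji.
by rewrite !mxE eq_sym (negbTE ji) mulr0.
Qed.

Lemma diff_gradient f x : differentiable f x -> 'd f x = inner (gradient f x) :> (vec -> R).
Proof.
move=> df; apply/funext => h.
rewrite [X in 'd f x X]vec_sum_delta linear_sum/= /inner; apply: eq_bigr => i _.
by rewrite linearZ/= mxE deriveE// mulrC.
Qed.

Lemma differentiable_innerE G x (w : vec) : differentiable G x ->
  differentiable (fun y => inner w (G y)) x /\
  'd (fun y => inner w (G y)) x = inner w \o 'd G x :> (vec -> R).
Proof.
move=> dG.
have dw y : differentiable (inner w) y.
  exact/linear_differentiable/inner_continuous.
split; first exact: (differentiable_comp dG (dw _)).
rewrite (diff_comp dG (dw _)) diff_lin//; exact: inner_continuous.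
Qed.

Lemma entryE G i : (fun y => G y i 0) = (fun y => inner (delta_mx i 0) (G y)).
Proof. by apply/funext => y; rewrite innerC inner_delta. Qed.

Lemma differentiable_vec G x : (forall i, differentiable (fun y => G y i 0) x) ->
  differentiable G x.
Proof.
move=> dG.
have -> : G = \sum_(i < n) (fun y => G y i 0 *: (delta_mx i 0 : vec)).
  by apply/funext => y; rewrite fct_sumE -vec_sum_delta.
apply: differentiable_sum => i.
have ds : differentiable (fun r : R => r *: (delta_mx i 0 : vec)) (G x i 0).
  exact: (@ex_diff _ _ _ _ _ _ _ (is_diff_scalel _ _)).
exact: (differentiable_comp (dG i) ds).
Qed.

Lemma hessian_mul f x (h : vec) : differentiable (gradient f) x ->
  'd (gradient f) x h = hessian f x *m h.
Proof.
move=> dG; apply/colP => i; rewrite mxE.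
have [di dE] := differentiable_innerE (delta_mx i 0) dG.
have -> : 'd (gradient f) x h i 0 = 'd (fun y => gradient f y i 0) x h.
  by rewrite entryE dE /= innerC inner_delta.
rewrite [X in 'd _ x X]vec_sum_delta linear_sum; apply: eq_bigr => j _.
by rewrite linearZ/= mxE deriveE 1?mulrC// entryE.
Qed.

Lemma inner_mulmx (A : 'M[R]_n) (u v : vec) : inner u (A *m v) = inner (A^T *m u) v.
Proof.
rewrite /inner; under eq_bigr do rewrite mxE mulr_sumr.
rewrite exchange_big /=; apply: eq_bigr => j _.
rewrite mxE mulr_suml; apply: eq_bigr => i _; rewrite mxE; ring.
Qed.

End Calculus.

Section SecondOrder.
Context {R : realType} {n : nat}.
Local Notation vec := 'cV[R]_n.
Variable f : vec -> R.
Hypothesis df : forall x, differentiable f x.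

(** The mean value theorem applied to s |-> f (y + t b + s a) - f (y + s a)
    expresses the second difference by a difference of gradients, which the
    differential of the gradient at y approximates. *)
Lemma second_difference (y : vec) (e : R) : differentiable (gradient f) y -> 0 < e ->
  exists2 d, 0 < d & forall (a b : vec) (t : R), 0 < t -> t * (`|a| + `|b|) <= d ->
    `|f (y + t *: a + t *: b) - f (y + t *: a) - f (y + t *: b) + f y
      - t ^+ 2 * inner a (hessian f y *m b)| <=
    t ^+ 2 * (2 * e * n%:R * `|a| * (`|a| + `|b|)).
Proof.
move=> dG e0; have [d d0 H] := eps_differentiable dG e0.
exists d => // a b t t0 td.
pose psi (s : R) := f (y + t *: b + s *: a) - f (y + s *: a).
pose dpsi (s : R) := inner (gradient f (y + t *: b + s *: a)) a
                   - inner (gradient f (y + s *: a)) a.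
have psiD (s : R) : is_derive s 1 psi (dpsi s).
  apply: is_deriveB.
    by rewrite -diff_gradient//; exact: is_derive_along_line.
  by rewrite -diff_gradient//; exact: is_derive_along_line.
have psic : {within `[0, t], continuous psi}.
  apply: derivable_within_continuous => s _; exact: ex_derive.
have [s st] := MVT t0 (fun s _ => psiD s) psic.
rewrite in_itv/= in st; move: st => /andP[s0 st].
rewrite subr0 {1}/psi {1}/psi !scale0r !addr0 => E.
have -> : f (y + t *: a + t *: b) - f (y + t *: a) - f (y + t *: b) + f y =
    dpsi s * t by rewrite -E (addrAC y); ring.
rewrite /dpsi -innerBl.
have b1 : `|s *: a| <= t * `|a|.
  by rewrite normrZ ger0_norm ?ler_wpM2r// ltW.
have b2 : `|t *: b + s *: a| <= t * (`|a| + `|b|).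
  rewrite (le_trans (ler_normD _ _))// mulrDr addrC lerD//.
  by rewrite normrZ gtr0_norm.
have ab : t * `|a| <= t * (`|a| + `|b|) by rewrite ler_wpM2l ?lerDl// ltW.
have H1 := H _ (le_trans b2 td).
have H2 := H _ (le_trans b1 (le_trans ab td)).
pose r := gradient f (y + (t *: b + s *: a)) - gradient f (y + s *: a)
   - t *: (hessian f y *m b).
have rn : `|r| <= 2 * e * (t * (`|a| + `|b|)).
  have -> : r = (gradient f (y + (t *: b + s *: a)) - gradient f y 
        - 'd (gradient f) y (t *: b + s *: a))
     - (gradient f (y + s *: a) - gradient f y - 'd (gradient f) y (s *: a)).
    have -> : 'd (gradient f) y (t *: b + s *: a) =
        t *: (hessian f y *m b) + 'd (gradient f) y (s *: a).
      by rewrite [LHS]linearD/= -(hessian_mul b dG); congr (_ + _); exact: linearZ.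
    have tele (A B C D F : vec) : A - B - F = (A - C - (F + D)) - (B - C - D).
      by apply/colP => i; rewrite !mxE; ring.
    exact: tele.
  rewrite (le_trans (ler_normB _ _))//.
  rewrite (_ : 2 * e * _ = e * (t * (`|a| + `|b|)) + e * (t * (`|a| + `|b|))); last by ring.
  rewrite lerD//.
    by rewrite (le_trans H1)// ler_wpM2l// ltW.
  by rewrite (le_trans H2)//; apply: ler_wpM2l; [exact: ltW|exact: le_trans b1 ab].
rewrite (_ : _ - _ = t * inner r a); last first.
  rewrite /r !innerBl innerZl (innerC a) !addrA; ring.
rewrite normrM gtr0_norm// expr2 -mulrA ler_pM2l//.
rewrite (le_trans (inner_le _ _))//.
rewrite (_ : _ * (_ * _ * _) = n%:R * (2 * e * (t * (`|a| + `|b|))) * `|a|); last by ring.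
by rewrite ler_wpM2r// ler_wpM2l.
Qed.

(** The second difference is symmetric in a and b, so both bilinear
    approximations of it given by [second_difference] agree. *)
Lemma hessian_sym (y : vec) : differentiable (gradient f) y -> (hessian f y)^T = hessian f y.
Proof.
move=> dG.
have S (a b : vec) : inner a (hessian f y *m b) = inner b (hessian f y *m a).
  pose C := 2 * n%:R * (`|a| + `|b|) * (`|a| + `|b|).
  have C0 : 0 <= C by rewrite !mulr_ge0// addr_ge0.
  apply/eqP; rewrite -subr_eq0 -normr_le0; apply/ler_addgt0Pr => e e0; rewrite add0r.
  have e'0 : 0 < e / (C + 1) by rewrite divr_gt0// ltr_wpDl.
  have [d d0 H] := second_difference dG e'0.
  pose N := `|a| + `|b| + 1.
  have N0 : 0 < N by rewrite ltr_wpDl// addr_ge0.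
  pose t := d / N.
  have t0 : 0 < t by rewrite divr_gt0.
  have tN : t * (`|a| + `|b|) <= d.
    rewrite (@le_trans _ _ (t * N))// ?ler_pM2l// ?lerDl//.
    by rewrite /t divfK ?gt_eqF.
  have := H b a t t0; rewrite [`|b| + _]addrC => /(_ tN).
  have := H a b t t0 tN.
  rewrite (_ : y + t *: b + t *: a = y + t *: a + t *: b); last by rewrite addrAC.
  set e' := e / (C + 1) in e'0 *.
  set u := inner a _; set w := inner b _.
  set F1 := f (_ + _ + _); set F2 := f (_ + _); set F3 := f (_ + _); set F4 := f y.
  move=> Hu Hw; have t20 : 0 < t ^+ 2 by rewrite exprn_gt0.
  rewrite -(ler_pM2l t20) -[X in X * `|_|]gtr0_norm// -normrM.
  have -> : t ^+ 2 * (u - w) = (F1 - F3 - F2 + F4 - t ^+ 2 * w)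
    - (F1 - F2 - F3 + F4 - t ^+ 2 * u).
    by ring.
  rewrite (le_trans (ler_normB _ _))//.
  rewrite (@le_trans _ _ (t ^+ 2 * (e' * C)))//.
    rewrite (_ : e' * C = (2 * e' * n%:R * `|b| * (`|a| + `|b|)) + (2 * e' * n%:R * `|a| * (`|a| + `|b|))).
      by rewrite mulrDr lerD.
    by rewrite /C; ring.
  rewrite ler_pM2l// /e' mulrAC ler_pdivrMr ?ltr_wpDl// ler_pM2l// lerDl//.
apply/matrixP => i j; rewrite mxE.
have := S (delta_mx j 0) (delta_mx i 0).
have E k l : inner (delta_mx k 0) (hessian f y *m delta_mx l 0) = hessian f y k l.
  by rewrite innerC inner_delta -colE mxE.
by rewrite !E.
Qed.

End SecondOrder.

(** * Convex hulls of compact sets *)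

Section ConvexHull.
Context {R : realType}.

Lemma convex_setP (M : lmodType R) (A : set M) : convex_set (A : set (convex_lmodType M)) <->
  forall x y t, A x -> A y -> 0 <= t -> t <= 1 -> A (t *: x + (1 - t) *: y).
Proof.
split=> [cA x y t Ax Ay t0 t1|cA x y t /set_mem Ax /set_mem Ay]; last first.
  by apply/mem_set; apply: cA.
have t01 : Itv.spec (@Itv.num_sem R) (Itv.Real `[0, 1]%Z) t.
  by rewrite /Itv.spec/= /Itv.num_sem/= in_itv/= t0 t1 ger0_real.
have := cA x y (Itv.mk t01); rewrite !inE; exact.
Qed.

Lemma convex_hull_sub (M : lmodType R) (A : set M) : A `<=` convex_hull A.
Proof. exact: sub_smallest. Qed.

Lemma convex_hull_convex (M : lmodType R) (A : set M) : convex_set (convex_hull A).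
Proof.
apply/convex_setP => x y t Ax Ay t0 t1 C [cC AC].
by apply: ((convex_setP C).1 cC) => //; [exact: Ax|exact: Ay].
Qed.

Lemma convex_hull_min (M : lmodType R) (A C : set M) :
  convex_set (C : set (convex_lmodType M)) -> A `<=` C -> convex_hull A `<=` C.
Proof. by move=> cC AC x; apply; split. Qed.

Lemma image_convex_hull (M N : lmodType R) (phi : {linear M -> N}) (A : set M) :
  phi @` (convex_hull A) = convex_hull (phi @` A).
Proof.
apply/seteqP; split.
  move=> _ [x Ax <-].
  suff : convex_hull A `<=` phi @^-1` (convex_hull (phi @` A)) by exact.
  apply: convex_hull_min; last first.
    by move=> y Ay; apply: convex_hull_sub; exists y.
  apply/convex_setP => y z t Ay Az t0 t1 /=.
  by rewrite linearD !linearZ/=; exact: ((convex_setP _).1 (@convex_hull_convex _ _)).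
apply: convex_hull_min; last by move=> _ [x Ax <-]; exists x => //; exact: convex_hull_sub.
apply/convex_setP => _ _ t [x Ax <-] [y Ay <-] t0 t1.
exists (t *: x + (1 - t) *: y); last by rewrite linearD !linearZ.
exact: ((convex_setP _).1 (@convex_hull_convex _ _)).
Qed.

Definition convex_combination (M : lmodType R) (N : nat) (K : set M) (v : M) :=
  exists (x : 'I_N -> M) (l : 'I_N -> R), [/\ forall i, K (x i), forall i, 0 <= l i,
    \sum_i l i = 1 & v = \sum_i l i *: x i].

Lemma convex_combination_hull (M : lmodType R) (N : nat) (K : set M) (v : M) :
  convex_combination N K v -> convex_hull K v.
Proof.
elim: N v => [|N IH] v [x [l [Kx l0 l1 ->]]].
  by move: l1; rewrite big_ord0 => /esym/eqP; rewrite oner_eq0.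
rewrite big_ord_recl; rewrite big_ord_recl in l1.
set s := \sum_(i < N) _ in l1.
have s0 : 0 <= s by apply: sumr_ge0.
have [sE|sN] := eqVneq s 0.
  rewrite sE addr0 in l1.
  rewrite big1 ?addr0 ?l1 ?scale1r; first exact: convex_hull_sub.
  move=> i _; rewrite (_ : l _ = 0) ?scale0r//.
  by apply: (psumr_eq0P (P := xpredT) (F := fun i => l (lift ord0 i))).
have tE : l ord0 = 1 - s by rewrite -l1 addrK.
rewrite tE addrC.
rewrite (_ : \sum_(i < N) _ = s *: \sum_(i < N) (l (lift ord0 i) / s) *: x (lift ord0 i)); last first.
  rewrite scaler_sumr; apply: eq_bigr => i _.
  by rewrite scalerA mulrCA divff// mulr1.
apply: ((convex_setP _).1 (@convex_hull_convex _ _)) => //; last 2 first.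
- exact: convex_hull_sub.
- by rewrite -subr_ge0 -tE.
apply: IH; exists (fun i => x (lift ord0 i)), (fun i => l (lift ord0 i) / s); split => //.
  by move=> i; rewrite divr_ge0.
by rewrite -mulr_suml divff.
Qed.

Lemma convex_combination_cons (M : lmodType R) (N : nat) (K : set M) (p u : M) t :
  convex_combination N K p -> K u -> 0 <= t -> t <= 1 ->
  convex_combination N.+1 K (t *: u + (1 - t) *: p).
Proof.
move=> [x [l [Kx l0 l1 ->]]] Ku t0 t1.
exists (fun i => if unlift ord0 i is Some j then x j else u).
exists (fun i => if unlift ord0 i is Some j then (1 - t) * l j else t).
split=> [i|i||]; rewrite ?big_ord_recl ?unlift_none.
- by case: unliftP.
- by case: unliftP => // j _; rewrite mulr_ge0// subr_ge0.
- under eq_bigr do rewrite liftK.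
  by rewrite -mulr_sumr l1 mulr1 addrC subrK.
- congr (_ + _); rewrite scaler_sumr; apply: eq_bigr => i _.
  by rewrite liftK scalerA.
Qed.

(** Caratheodory's argument: n + 2 points have an affine dependency c, and moving
    the weights along c until the first of them vanishes frees one point. *)
Lemma caratheodory_step n (K : set 'cV[R]_n) (v : 'cV[R]_n) :
  convex_combination n.+2 K v -> convex_combination n.+1 K v.
Proof.
move=> [x [l [Kx l0 l1 vE]]].
have [c c0 [c1 cx]] : exists2 c : 'I_n.+2 -> R, (exists i, c i != 0) &
    \sum_i c i = 0 /\ \sum_i c i *: x i = 0.
  (* The row i of A is the point x i followed by 1; a row vector killing A on its
     left is an affine dependency. *)
  pose A : 'M[R]_(n.+2, n + 1) := \matrix_(i, j) (col_mx (x i) (const_mx 1 : 'cV_1)) j 0.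
  have : kermx A != 0.
    rewrite kermx_eq0 /row_free neq_ltn (leq_ltn_trans (rank_leq_col A))//.
    by rewrite addn1.
  move=> /rowV0Pn[u /sub_kermxP uA u0].
  exists (fun i => u 0 i); first exact/rV0Pn.
  split.
    have := congr1 (fun B : 'rV_(n + 1) => B 0 (rshift n 0)) uA; rewrite !mxE => uA'.
    rewrite -[RHS]uA'; apply: eq_bigr => i _.
    by rewrite !mxE (unsplitK (inr _)) mxE mulr1.
  apply/colP => k; rewrite summxE.
  have := congr1 (fun B : 'rV_(n + 1) => B 0 (lshift 1 k)) uA; rewrite !mxE => uA'.
  rewrite -[RHS]uA'; apply: eq_bigr => i _.
  by rewrite !mxE (unsplitK (inl _)).
have [i0 ci0] : exists i, 0 < c i.
  apply: contrapT => /forallNP H.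
  have cneg i : c i <= 0 by rewrite leNgt; apply/negP; exact: H.
  case: c0 => j; apply/negP; rewrite negbK -oppr_eq0; apply/eqP.
  apply: (psumr_eq0P (P := xpredT) (F := fun i => - c i)) => //.
    by move=> i _; rewrite oppr_ge0.
  by rewrite sumrN c1 oppr0.
pose m := [arg min_(i < i0 | 0 < c i) (l i / c i)]%O.
have [cm mP] : 0 < c m /\ forall j, 0 < c j -> l m / c m <= l j / c j.
  by rewrite /m; case: arg_minP => // i ci H; split => // j cj; exact: H.
pose t := l m / c m.
have t0 : 0 <= t by rewrite divr_ge0// ltW.
pose l' i := l i - t * c i.
have l'0 i : 0 <= l' i.
  rewrite /l' subr_ge0; have [ci|ci] := ltrP 0 (c i).
    by rewrite -ler_pdivlMr//; exact: mP.
  by rewrite (le_trans _ (l0 i))// mulr_ge0_le0.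
have l'm : l' m = 0 by rewrite /l' /t divfK ?subrr// gt_eqF.
have l'1 : \sum_i l' i = 1 by rewrite sumrB -mulr_sumr c1 mulr0 subr0.
have l'v : v = \sum_i l' i *: x i.
  under eq_bigr do rewrite scalerBl -scalerA.
  by rewrite sumrB -scaler_sumr cx scaler0 subr0.
exists (fun i => x (lift m i)), (fun i => l' (lift m i)); split => //.
  by rewrite -l'1 (bigD1_ord m)//= l'm add0r.
by rewrite l'v (bigD1_ord m)//= l'm scale0r add0r.
Qed.

End ConvexHull.

Section Compactness.
Context {R : realType}.

Lemma vec_mx_continuous m n : continuous (vec_mx : 'rV[R]_(m * n) -> 'M[R]_(m, n)).
Proof.
apply: (@lipschitz_bound_continuous _ _ _ _ 1) => u v.
rewrite mul1r -linearB/=; apply/mx_norm_leP => // i j.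
by rewrite mxE; exact: entry_le_norm.
Qed.

(** The norm-preserving map [vec_mx] carries this property over from row
    vectors. *)
Lemma mx_bounded_closed_compact m n (A : set 'M[R]_(m, n)) (b : R) :
  (forall M, A M -> `|M| <= b) -> closed A -> compact A.
Proof.
move=> Ab cA.
have -> : A = vec_mx @` (vec_mx @^-1` A).
  apply/seteqP; split => [M AM|_ [u Au <-]//].
  by exists (mxvec M); rewrite /= mxvecK.
apply: continuous_compact.
  by apply: continuous_subspaceT; exact: vec_mx_continuous.
apply: bounded_closed_compact.
  exists b; split; first exact: num_real.
  move=> r br u /= /Ab ub; apply: le_trans (ltW br).
  rewrite -(vec_mxK u); apply/mx_norm_leP => [|i k].
    exact: le_trans (normr_ge0 _) ub.
  case/mxvec_indexP: k => k l; rewrite ord1 mxvecE.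
  exact: le_trans (entry_le_norm _ _ _) ub.
by apply: preimage_closed => // u _; exact: vec_mx_continuous.
Qed.

Lemma continuous_sumr (T : topologicalType) (I : Type) (r : seq I) (F : I -> T -> R) :
  (forall i, continuous (F i)) -> continuous (fun t => \sum_(i <- r) F i t).
Proof.
move=> Fc t; elim: r => [|i r IH].
  rewrite (_ : (fun t => _) = cst 0); first exact: cvg_cst.
  by apply/funext => s; rewrite big_nil.
rewrite (_ : (fun t => _) = (fun t => F i t + \sum_(i <- r) F i t)); last first.
  by apply/funext => s; rewrite big_cons.
by apply: cvgD; [exact: Fc|exact: IH].
Qed.

Lemma continuous_mulr (T : topologicalType) (F G : T -> R) :
  continuous F -> continuous G -> continuous (fun t => F t * G t).
Proof. by move=> Fc Gc t; apply: cvgM; [exact: Fc|exact: Gc]. Qed.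

Lemma continuous_subr (T : topologicalType) (F G : T -> R) :
  continuous F -> continuous G -> continuous (fun t => F t - G t).
Proof. by move=> Fc Gc t; apply: cvgB; [exact: Fc|exact: Gc]. Qed.

End Compactness.

Section Support.
Context {R : realType} {n : nat}.
Local Notation vec := 'cV[R]_n.
Implicit Types (K : set vec) (v : vec).

Definition simplex (N : nat) : set 'cV[R]_N :=
  [set l : 'cV[R]_N | (forall i, 0 <= l i 0) /\ \sum_i l i 0 = 1].

Lemma simplex_compact N : compact (@simplex N).
Proof.
apply: (@mx_bounded_closed_compact _ _ _ _ 1).
  move=> l [l0 l1]; apply/mx_norm_leP => // i j; rewrite ord1 ger0_norm//.
  by rewrite -l1 (bigD1 i)//= lerDl sumr_ge0.
rewrite (_ : @simplex N = \bigcap_i [set l | 0 <= l i 0] `&` [set l | \sum_i l i 0 = 1]); last first.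
  by apply/seteqP; split => l [l0 l1]; split => //= i *; exact: l0.
apply: closedI.
  apply: closed_bigI => i _.
  apply: (@preimage_closed _ _ (fun l : 'cV[R]_N => l i 0) [set r | 0 <= r]);
    last exact: closed_ge.
  by move=> l _; exact: coord_continuous.
apply: (@preimage_closed _ _ (fun l : 'cV[R]_N => \sum_i l i 0) [set r | r = 1]);
  last exact: closed_eq.
by move=> l _; apply: continuous_sumr => i; exact: coord_continuous.
Qed.

Lemma columns_compact N K : compact K ->
  compact [set X : 'M[R]_(n, N) | forall j, K (col j X)].
Proof.
move=> cK.
have [b [_ bK]] := compact_bounded cK.
apply: (@mx_bounded_closed_compact _ _ _ _ (`|b| + 1)).
  move=> X KX; apply/mx_norm_leP => // i j.
  have -> : X i j = col j X i 0 by rewrite mxE.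
  apply: le_trans (entry_le_norm _ _ _) _.
  by apply: bK (KX j); rewrite (le_lt_trans (ler_norm _))// ltrDl.
rewrite (_ : [set X | _] = \bigcap_j (col j @^-1` K)); last first.
  by apply/seteqP; split => X KX j *; exact: KX.
apply: closed_bigI => j _.
apply: preimage_closed; last exact: compact_closed (@norm_hausdorff _ _) cK.
move=> X _; apply: (@lipschitz_bound_continuous _ _ _ _ 1) => Y Z.
rewrite mul1r -linearB/=; apply/mx_norm_leP => // i k.
by rewrite mxE; exact: entry_le_norm.
Qed.

Lemma inner_ge0 v : 0 <= inner v v.
Proof. by apply: sumr_ge0 => i _; rewrite -expr2 sqr_ge0. Qed.

Lemma inner_eq0 v : inner v v = 0 -> v = 0.
Proof.
move=> /psumr_eq0P H; apply/colP => i; rewrite mxE; apply/eqP.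
by rewrite -sqrf_eq0 expr2 H// => j _; rewrite -expr2 sqr_ge0.
Qed.

Lemma nearest_combination N K v : compact K -> K !=set0 ->
  exists2 p, convex_combination N.+1 K p &
    forall q, convex_combination N.+1 K q -> inner (p - v) (p - v) <= inner (q - v) (q - v).
Proof.
move=> cK [u Ku].
pose S : set ('M[R]_(n, N.+1) * 'cV[R]_N.+1) :=
  [set X : 'M[R]_(n, N.+1) | forall j, K (col j X)] `*` @simplex N.+1.
have cS : compact S by apply: compact_setX; [exact: columns_compact|exact: simplex_compact].
have S0 : S !=set0.
  exists (\matrix_(i, j) u i 0, delta_mx ord0 0); split => /=.
    by move=> j; rewrite (_ : col j _ = u)//; apply/colP => i; rewrite !mxE.
  split=> [i|]; first by rewrite mxE ler0n.
  rewrite (bigD1 ord0)//= mxE !eqxx big1 ?addr0// => i /negbTE i0.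
  by rewrite mxE i0.
pose F (p : 'M[R]_(n, N.+1) * 'cV[R]_N.+1) := inner (p.1 *m p.2 - v) (p.1 *m p.2 - v).
have Fc : continuous F.
  have Ei i : continuous (fun p : 'M[R]_(n, N.+1) * 'cV[R]_N.+1 => (p.1 *m p.2 - v) i 0).
    rewrite (_ : (fun p => _) = (fun p : 'M[R]_(n, N.+1) * 'cV[R]_N.+1 =>
      \sum_j p.1 i j * p.2 j 0 - v i 0)); last by apply/funext => p; rewrite !mxE.
    apply: continuous_subr; last by move=> p; exact: cvg_cst.
    apply: continuous_sumr => j; apply: continuous_mulr => p.
      exact: (continuous_comp (f := fst) (g := fun X : 'M[R]_(n, N.+1) => X i j)
        cvg_fst (@coord_continuous _ _ _ _ _ _)).
    exact: (continuous_comp (f := snd) (g := fun X : 'cV[R]_N.+1 => X j 0)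
      cvg_snd (@coord_continuous _ _ _ _ _ _)).
  by apply: continuous_sumr => i; exact: continuous_mulr.
have [[X l] /set_mem[/= KX [l0 l1]] Xmin] := compact_EVT_min S0 cS (continuous_subspaceT Fc).
have mulE (Y : 'M[R]_(n, N.+1)) (m : 'cV[R]_N.+1) : Y *m m = \sum_i m i 0 *: col i Y.
  apply/colP => i; rewrite mxE summxE; apply: eq_bigr => j _.
  by rewrite !mxE mulrC.
exists (X *m l).
  by exists (fun j => col j X), (fun j => l j 0); split.
move=> q [x [m [Kx m0 m1 ->]]].
have qE : (\matrix_(i, j) x j i 0) *m (\col_j m j) = \sum_i m i *: x i :> 'cV[R]_n.
  rewrite mulE; apply: eq_bigr => i _; rewrite mxE; congr (_ *: _).
  by apply/colP => k; rewrite !mxE.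
have := Xmin (\matrix_(i, j) x j i 0, \col_j m j); rewrite /F/= qE.
apply; apply/mem_set; split => /=.
  by move=> j; rewrite (_ : col j _ = x j)//; apply/colP => k; rewrite !mxE.
split=> [i|]; first by rewrite mxE.
by rewrite -m1; apply: eq_bigr => i _; rewrite mxE.
Qed.

(** Let p be a nearest point to v among the combinations of n + 1 points of K.
    If p <> v, a point u of K with <v - p, v> <= <v - p, u> lies on the side of v,
    so moving p slightly towards u brings it closer to v.  The point reached is a
    combination of n + 2 points, hence of n + 1 points by [caratheodory_step],
    which contradicts the choice of p. *)
Theorem convex_hull_of_support K v : compact K ->
  (forall d, exists2 u, K u & inner d v <= inner d u) -> convex_hull K v.
Proof.
move=> cK H.
have K0 : K !=set0 by have [u Ku _] := H 0; exists u.
have [p pK pmin] := nearest_combination n v cK K0.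
suff -> : v = p by exact: convex_combination_hull pK.
pose D := inner (p - v) (p - v).
have D0 : 0 <= D by exact: inner_ge0.
have [/eqP D00|Dn0] := boolP (D == 0).
  by apply/esym/eqP; rewrite -subr_eq0; apply/eqP/inner_eq0.
have Dp : 0 < D by rewrite lt_neqAle eq_sym Dn0.
have [u Ku uv] := H (v - p).
pose B := inner (u - v) (u - v).
have B0 : 0 <= B by exact: inner_ge0.
pose c := inner (u - v) (p - v).
have c0 : c <= 0.
  rewrite /c innerC innerBr -(opprB v p) -scaleN1r !innerZl.
  by move: uv; lra.
(* For this t the squared distance (1 - t)^2 D + 2 t (1 - t) c + t^2 B from the
   new point to v is at most (1 - t) D. *)
pose t := D / (D + B).
have DB : 0 < D + B by rewrite ltr_wpDr.
have t0 : 0 < t by rewrite divr_gt0.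
have t1 : t <= 1 by rewrite ler_pdivrMr// mul1r lerDl.
have := pmin _ (caratheodory_step (convex_combination_cons pK Ku (ltW t0) t1)).
rewrite -/D (_ : _ - v = t *: (u - v) + (1 - t) *: (p - v)); last first.
  by apply/colP => i; rewrite !mxE; ring.
rewrite !innerDl !innerDr !innerZl !innerZr -/B -/D -/c (innerC (p - v)) -/c => E.
have tE : t * (D + B) = D by rewrite /t divfK// gt_eqF.
exfalso.
have : 0 <= t * (1 - t) by rewrite mulr_ge0 ?subr_ge0// ltW.
nra.
Qed.

End Support.

(** * The Clarke Hessian and the scalarized gradient *)

Section ClarkeHessian.
Context {R : realType} {n : nat}.
Local Notation vec := 'cV[R]_n.
Local Notation leb := (@lebesgue_measure R).

Lemma lipschitz_constant (V W : normedModType R) (G : V -> W) : lipschitz G ->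
  exists2 L, 0 <= L & forall x y, `|G x - G y| <= L * `|x - y|.
Proof.
move=> [M [_ H]]; exists (`|M| + 1) => [|x y]; first by rewrite addr_ge0.
have Ml : M < `|M| + 1 by rewrite (le_lt_trans (ler_norm _))// ltrDl.
exact: (H _ Ml (x, y)).
Qed.

Lemma mulmx_norm_le m (A : 'M[R]_(m, n)) (w : vec) : `|A *m w| <= n%:R * `|A| * `|w|.
Proof.
apply/mx_norm_leP => [|i j]; first by rewrite !mulr_ge0.
rewrite mxE (le_trans (ler_norm_sum _ _ _))//.
rewrite -mulrA -[n in n%:R]card_ord mulr_natl -sumr_const.
by apply: ler_sum => k _; rewrite normrM ler_pM// entry_le_norm.
Qed.

Lemma mulmxr_continuous m (w : vec) : continuous (fun A : 'M[R]_(m, n) => A *m w).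
Proof.
apply: (@lipschitz_bound_continuous _ _ _ _ (n%:R * `|w|)) => A B.
by rewrite -mulmxBl (le_trans (mulmx_norm_le _ _))// mulrAC.
Qed.

Variable f : vec -> R.
Hypothesis hf : C11 f.

Let df x : differentiable f x := hf.1 x.

Lemma twice_differentiableE y : twice_differentiable f y <-> differentiable (gradient f) y.
Proof.
split=> [[_ dG]//|dG]; apply: conj dG; exact: (@nearW _ (nbhs y) _ _ df).
Qed.

Lemma hessian_bounded :
  exists b, forall y, differentiable (gradient f) y -> `|hessian f y| <= b.
Proof.
have [L L0 GL] := lipschitz_constant hf.2.
exists (L + 1) => y dG; apply/mx_norm_leP => [|i j]; first by rewrite addr_ge0.
have [d d0 H] := eps_differentiable dG ltr01.
pose e : vec := delta_mx j 0.
have en : `|d *: e| <= d.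
  apply/mx_norm_leP => [|k l]; first exact: ltW.
  rewrite !mxE normrM gtr0_norm// ger_pMr//.
  by case: (_ && _); rewrite ?normr1 ?normr0.
have := H _ en; rewrite mul1r (hessian_mul _ dG) => He.
have : `|hessian f y *m (d *: e)| <= (L + 1) * d.
  rewrite -(subrK (gradient f (y + d *: e) - gradient f y) (_ *m _)).
  rewrite (le_trans (ler_normD _ _))// addrC mulrDl mul1r lerD//.
    by rewrite (le_trans (GL _ _))// addrAC subrr add0r ler_wpM2l.
  by rewrite -normrN opprB (le_trans He).
rewrite -scalemxAr normrZ gtr0_norm// mulrC ler_pM2r// => Hn.
have -> : hessian f y i j = (hessian f y *m e) i 0 by rewrite /e -colE [RHS]mxE.
exact: le_trans (entry_le_norm _ _ _) Hn.
Qed.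

(** Without sequences, limiting Hessians visibly form a closed set. *)
Lemma limiting_hessiansP x A : limiting_hessians f x A <->
  forall e, 0 < e -> exists y,
    [/\ differentiable (gradient f) y, `|x - y| <= e & `|A - hessian f y| <= e].
Proof.
split=> [[y [ydiff yx yA]] e e0|H].
  near \oo => j; exists (y j); split.
  - exact/twice_differentiableE.
  - by near: j; move/cvgrPdist_le : yx; exact.
  - by near: j; move/cvgrPdist_le : yA; exact.
have e0 j : 0 < j.+1%:R^-1 :> R by rewrite invr_gt0.
pose y j := projT1 (cid (H _ (e0 j))).
have yP j : [/\ differentiable (gradient f) (y j), `|x - y j| <= j.+1%:R^-1 &
    `|A - hessian f (y j)| <= j.+1%:R^-1] := projT2 (cid (H _ (e0 j))).
exists y; split.
- by move=> j; apply/twice_differentiableE; have [] := yP j.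
- apply/cvgrPdist_le => e e1; apply: filterS (near_inv_le e1) => j.
  by apply: le_trans; have [] := yP j.
- apply/cvgrPdist_le => e e1; apply: filterS (near_inv_le e1) => j.
  by apply: le_trans; have [] := yP j.
Unshelve. all: by end_near. Qed.

Lemma limiting_hessians_compact x : compact (limiting_hessians f x).
Proof.
have [b bH] := hessian_bounded.
apply: (@mx_bounded_closed_compact _ _ _ _ (b + 1)).
  move=> A /limiting_hessiansP/(_ _ ltr01)[y [dG _ Ay]].
  rewrite -(subrK (hessian f y) A) (le_trans (ler_normD _ _))// addrC lerD//.
  exact: bH.
move=> A clA; apply/limiting_hessiansP => e e0.
have e20 : 0 < e / 2 by rewrite divr_gt0.
have [B [/limiting_hessiansP/(_ _ e20)[y [dG xy By]] AB]] := clA _ (nbhsx_ballx A _ e20).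
exists y; split => //; first by rewrite (le_trans xy)// ler_pdivrMr// ler_pMr// ler1n.
rewrite -(subrK B A) -addrA (le_trans (ler_normD _ _))// [leRHS]splitr lerD//.
by move: AB; rewrite -ball_normE => /ltW.
Qed.

Section Scalarization.
Variable w : vec.
Let g (y : vec) := inner w (gradient f y).

Lemma scalarized_gradient y : differentiable (gradient f) y ->
  differentiable g y /\ gradient g y = hessian f y *m w.
Proof.
move=> dG; have [dg dgE] := differentiable_innerE w dG; split => //.
apply/colP => j; rewrite mxE deriveE// dgE /= (hessian_mul _ dG).
by rewrite inner_mulmx hessian_sym// inner_delta.
Qed.

Lemma limiting_hessian_gradient x A :
  limiting_hessians f x A -> limiting_gradients g x (A *m w).
Proof.
move=> [y [ydiff yx yA]]; exists y.
have dG j := (twice_differentiableE (y j)).1 (ydiff j).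
split => // [j|]; first exact: (scalarized_gradient (dG j)).1.
rewrite (_ : (fun j => gradient g (y j)) = (fun j => hessian f (y j) *m w)).
  exact: (cvg_comp _ _ yA (@mulmxr_continuous n w A)).
by apply/funext => j; rewrite (scalarized_gradient (dG j)).2.
Qed.


(** If <d, H(z) w> were smaller than <d, v> - e at all points z near x where
    grad f is differentiable, the mean value inequality along a line with
    direction d that meets the other points in a null set would bound the
    increment of g by t (<d, v> - e).  But this increment is at least
    t (<d, v> - 3 e / 4), by differentiability of g at a nearby point. *)
Lemma nearby_hessian x v (d : vec) (e : R) : limiting_gradients g x v -> 0 < e ->
  exists z, [/\ differentiable (gradient f) z, `|x - z| <= e &
    inner d v - e <= inner d (hessian f z *m w)].
Proof.
move=> [ys [ydiff yx yv]] e0.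
have [L L0 GL] := lipschitz_constant hf.2.
pose M := n%:R * `|w| * L.
have M0 : 0 <= M by rewrite !mulr_ge0.
have gL p q : `|g p - g q| <= M * `|p - q|.
  by rewrite /g -innerBr (le_trans (inner_le _ _))// /M -[leRHS]mulrA ler_wpM2l// mulr_ge0.
have e4 : 0 < e / 4 by rewrite divr_gt0.
pose D := n%:R * `|d| + 1.
have D0 : 0 < D by rewrite ltr_wpDl// mulr_ge0.
have [y [dg xy vy]] : exists y, [/\ differentiable g y, `|x - y| <= e / 4 &
    `|v - gradient g y| <= e / 4 / D].
  near \oo => j; exists (ys j); split => //.
    by near: j; move/cvgrPdist_le : yx; exact.
  by near: j; move/cvgrPdist_le : yv; apply; rewrite divr_gt0.
have dv : inner d v - e / 4 <= inner d (gradient g y).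
  have : `|inner d (v - gradient g y)| <= e / 4.
    rewrite (le_trans (inner_le _ _))// (@le_trans _ _ (D * `|v - gradient g y|))//.
      by rewrite ler_wpM2r// lerDl.
    by rewrite -ler_pdivlMl// mulrC.
  by rewrite innerBr ler_norml => /andP[_]; lra.
have N0 : 0 < `|d| + 1 by rewrite ltr_wpDl.
have e'0 : 0 < e / 4 / (`|d| + 1) by rewrite divr_gt0.
have [r r0 gr] := eps_differentiable dg e'0.
pose t := Num.min r (e / 4) / (`|d| + 1).
have m0 : 0 < Num.min r (e / 4) by rewrite lt_min r0.
have t0 : 0 < t by rewrite divr_gt0.
have td : t * `|d| <= Num.min r (e / 4).
  rewrite /t mulrAC ler_pdivrMr// ler_pM2l//; lra.
have tdr : `|t *: d| <= r.
  by rewrite normrZ gtr0_norm// (le_trans td)// ge_min lexx.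
have tde : t * `|d| <= e / 4 by rewrite (le_trans td)// ge_min lexx orbT.
have incr : t * (inner d v - e / 2) <= g (y + t *: d) - g y.
  have := gr _ tdr; rewrite diff_gradient// innerZr innerC normrZ gtr0_norm//.
  have : e / 4 / (`|d| + 1) * (t * `|d|) <= t * (e / 4).
    rewrite mulrCA ler_pM2l// mulrAC ler_pdivrMr// ler_pM2l//; lra.
  rewrite ler_norml => H1 /andP[H2 _].
  have dv2 : t * (inner d v - e / 4) <= t * inner d (gradient g y) by rewrite ler_pM2l.
  move: H1 H2 dv2; clearbody t; lra.
have [P Pqi] := @exists_quasi_invariant R n.
have aeD : {ae P, forall z : vec, differentiable (gradient f) z}.
  have : {ae P, forall z : vec, forall i, differentiable (fun y => gradient f y i 0) z}.
    apply: ae_forall_countable => i.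
    apply: (lipschitz_ae_differentiable Pqi L0) => p q.
    rewrite (le_trans _ (GL p q))//.
    have -> : gradient f p i 0 - gradient f q i 0 = (gradient f p - gradient f q) i 0.
      by rewrite !mxE.
    exact: entry_le_norm.
  by apply: ae_imply => z; exact: differentiable_vec.
have aeL := lines_of_null Pqi d aeD.
(* Moving the base point y by less than rho changes the increment of g by at most
   t e / 4, and the new base point stays within e / 4 of y. *)
pose rho := Num.min (e / 4) (t * (e / 4) / (2 * M + 1)).
have M1 : 0 < 2 * M + 1 by lra.
have rho0 : 0 < rho by rewrite lt_min e4 divr_gt0// mulr_gt0.
have [q [yq qL]] : exists q : vec, `|y - q| < rho /\
    {ae leb, forall s, differentiable (gradient f) (q + s *: d)}.
  have bo : open (ball y rho) by apply: ball_open.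
  have b0 : ball y rho !=set0 by exists y; exact: ballxx.
  have [q [yq qL]] := ae_dense Pqi aeL b0 bo.
  exists q; split; first by move: yq; rewrite -ball_normE.
  by move: qL; apply: ae_imply => s /contrapT.
have incr' : t * (inner d v - 3 / 4 * e) <= g (q + t *: d) - g q.
  have Mr : M * `|y - q| + M * `|y - q| <= t * (e / 4).
    rewrite -mulrDl (@le_trans _ _ ((2 * M + 1) * rho))//.
      by rewrite ler_pM// ?addr_ge0// ?ltW//; lra.
    rewrite -ler_pdivlMl// mulrC /rho ge_min; apply/orP; right.
    by rewrite mulrC.
  have := gL (y + t *: d) (q + t *: d).
  rewrite opprD addrACA subrr addr0 ler_norml => /andP[_ G1].
  have := gL y q; rewrite ler_norml => /andP[G2 _].
  lra.
apply: contrapT => /forallNP noz.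
pose phi (s : R) := g (q + s *: d).
have phiL s s' : `|phi s - phi s'| <= (M * `|d|) * `|s - s'|.
  rewrite (le_trans (gL _ _))// opprD addrACA subrr add0r -scalerBl normrZ.
  by rewrite -mulrA (mulrC `|d|).
have : phi t - phi 0 <= (inner d v - e) * (t - 0).
  apply: (lipschitz_mean_value (L := M * `|d|)) => //; first by rewrite mulr_ge0.
    exact: ltW.
  move: qL; apply: ae_imply => s dG /andP[s0 st].
  have [dgs gE] := scalarized_gradient dG.
  rewrite (@derive_val _ _ _ _ _ _ _ (is_derive_along_line dgs)) diff_gradient// gE innerC.
  rewrite leNgt; apply/negP => lt; apply: (noz (q + s *: d)); split => //; last exact: ltW.
  have -> : x - (q + s *: d) = (x - y) + ((y - q) - s *: d).
    by apply/colP => i; rewrite !mxE; ring.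
  rewrite (le_trans (ler_normD _ _))//.
  have := ler_normB (y - q) (s *: d).
  have : `|s *: d| <= e / 4.
    by rewrite (le_trans _ tde)// normrZ gtr0_norm// ler_wpM2r// ltW.
  have : `|y - q| <= e / 4 by rewrite (le_trans (ltW yq))// ge_min lexx.
  lra.
rewrite /phi scale0r addr0 subr0.
have := mulr_gt0 t0 e4; lra.
Unshelve. all: by end_near. Qed.

(** The Hessians given by [nearby_hessian] for e = 1/(j+1) are bounded, and any
    cluster point of them is a limiting Hessian at x. *)
Lemma limiting_gradient_support x v (d : vec) : limiting_gradients g x v ->
  exists2 A, limiting_hessians f x A & inner d v <= inner d (A *m w).
Proof.
move=> xv; have [b bH] := hessian_bounded.
have e0 j : 0 < j.+1%:R^-1 :> R by rewrite invr_gt0.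
pose z j := projT1 (cid (nearby_hessian d xv (e0 j))).
have zP j : [/\ differentiable (gradient f) (z j), `|x - z j| <= j.+1%:R^-1 &
    inner d v - j.+1%:R^-1 <= inner d (hessian f (z j) *m w)] :=
  projT2 (cid (nearby_hessian d xv (e0 j))).
have cB : compact [set A : 'M[R]_n | `|A| <= b].
  apply: (@mx_bounded_closed_compact _ _ _ _ b) => //.
  apply: (@preimage_closed _ _ (fun A : 'M[R]_n => `|A|) [set r | r <= b]).
    by move=> A _; exact: norm_continuous.
  exact: closed_le.
pose F := (fun j => hessian f (z j)) @ \oo.
have FB : F [set A : 'M[R]_n | `|A| <= b].
  by exists 0%N => // j _; apply: bH; have [] := zP j.
have [A [_ clA]] := cB F _ FB.
have close e : 0 < e -> exists j, j.+1%:R^-1 <= e /\ `|A - hessian f (z j)| <= e.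
  move=> e1.
  have := clA [set B | exists j, j.+1%:R^-1 <= e /\ B = hessian f (z j)]
    (ball A e) _ (nbhsx_ballx A _ e1).
  case; first by apply: filterS (near_inv_le e1) => j je /=; exists j.
  move=> B [[j [je ->]] AB]; exists j; split => //.
  by move: AB; rewrite -ball_normE => /ltW.
exists A.
  apply/limiting_hessiansP => e e1; have [j [je Aj]] := close e e1.
  have [dG xz _] := zP j; exists (z j); split => //; exact: le_trans xz je.
apply/ler_addgt0Pr => e e1.
pose C := n%:R * `|d| * (n%:R * `|w|) + 1.
have C0 : 0 < C by rewrite ltr_wpDl// !mulr_ge0.
have e2 : 0 < Num.min (e / 2) (e / 2 / C) by rewrite lt_min !divr_gt0.
have [j []] := close _ e2; rewrite !le_min => /andP[j1 _] /andP[_ j2].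
have [_ _ zj] := zP j.
have : `|inner d ((A - hessian f (z j)) *m w)| <= e / 2.
  rewrite (le_trans (inner_le _ _))//.
  rewrite (@le_trans _ _ (C * `|A - hessian f (z j)|))//.
    rewrite (@le_trans _ _ (n%:R * `|d| * (n%:R * `|A - hessian f (z j)| * `|w|)))//.
      by rewrite ler_wpM2l ?mulr_ge0// mulmx_norm_le.
    have -> : n%:R * `|d| * (n%:R * `|A - hessian f (z j)| * `|w|) =
        n%:R * `|d| * (n%:R * `|w|) * `|A - hessian f (z j)| by ring.
    by rewrite ler_wpM2r// lerDl.
  by rewrite -ler_pdivlMl// mulrC.
rewrite mulmxBl innerBr ler_norml => /andP[H _].
move: zj j1 H; move: (j.+1%:R^-1) => q; lra.
Qed.

End Scalarization.
End ClarkeHessian.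

Theorem proposition2p4 (R : realType) (n : nat) (f : 'cV[R]_n -> R)
    (hf : C11 f) (x w : 'cV[R]_n) :
  clarke_hessian_apply f x w =
  clarke_subdifferential (fun y => inner w (gradient f y)) x.
Proof.
rewrite /clarke_hessian_apply -[LHS]/(mulmxr w @` _) image_convex_hull.
apply/seteqP; split; apply: convex_hull_min; try exact: convex_hull_convex.
  move=> _ [A xA <-]; apply: convex_hull_sub; exact: limiting_hessian_gradient.
move=> v xv; apply: convex_hull_of_support.
  apply: continuous_compact; last exact: limiting_hessians_compact.
  by apply: continuous_subspaceT; exact: mulmxr_continuous.
move=> d; have [A xA dA] := limiting_gradient_support hf d xv.
by exists (A *m w) => //; exists A.
Qed.
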